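(* There exist universal constants $c_0, c_1, C > 0$ such that for every sufficiently large $n$ and every real $R$ with $c_0\sqrt{n}\le R\le c_1 n$, there exists a convex body $K\subset\mathbb{R}^n$ whose John ellipsoid is centered at the origin and such that any polytope $P\subset\mathbb{R}^n$ satisfying $$K\subset P\subset RK$$ has at least $$\exp\left(C\,\log\left(\frac{R^2}{n}\right)\frac{n}{R^2}\,n\right)$$ facets.
   Context: A convex body in $\mathbb{R}^n$ is a compact convex set with non-empty interior. The John ellipsoid of a convex body $K$ is the unique ellipsoid of maximal volume contained in $K$ (it need not be centered at the origin in general). A polytope is a compact convex polytope, and its number of facets is the number of its $(n-1)$-dimensional faces. For $R>0$, $RK=\{Rx : x\in K\}$. ''Universal'' constants do not depend on $n$, $R$, $K$ or $P$, and ''sufficiently large $n$'' means $n\ge n_0$ for a universal $n_0$. *)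

(* Defs.v *)
From mathcomp Require Import all_boot all_order all_algebra.
From mathcomp Require Import all_classical all_reals all_analysis.

Set Implicit Arguments.
Unset Strict Implicit.
Unset Printing Implicit Defensive.
Import Order.TTheory GRing.Theory Num.Theory.
Import numFieldNormedType.Exports.
Local Open Scope classical_set_scope.
Local Open Scope ring_scope.

(* R^n is 'rV[R]_n.  Its library topology comes from the sup norm, which is
   equivalent to the Euclidean norm; the latter is not in the library. *)

Definition dotp (R : realType) (n : nat) (x y : 'rV[R]_n) : R :=
  \sum_(i < n) x 0 i * y 0 i.

Definition convex_body (R : realType) (n : nat) (K : set 'rV[R]_n) : Prop :=
  [/\ compact K, convex_set K & K° !=set0].

(* Lebesgue measure on R^n as the n-fold iterate of the product measure
   [lebesgue_measure \x _], with [product_measure1] unfolded: the measure of A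
   is the integral over the first coordinate t of the (n-1)-dimensional measure
   of the section of A at t.  It is the Lebesgue measure on Borel sets, hence on
   ellipsoids; its values elsewhere are not used. *)
Fixpoint volume (R : realType) (n : nat) : set 'rV[R]_n -> \bar R :=
  match n with
  | 0 => fun A => (\1_A (0 : 'rV[R]_0))%:E
  | m.+1 => fun A =>
      (\int[lebesgue_measure]_t
         volume [set y : 'rV[R]_m | A (row_mx (t : R)%:M y)])%E
  end.

Definition unit_ball (R : realType) (n : nat) : set 'rV[R]_n :=
  [set x | Num.sqrt (dotp x x) <= 1].

Definition ellipsoid_centered_at (R : realType) (n : nat) (c : 'rV[R]_n)
    (E : set 'rV[R]_n) : Prop :=
  exists2 A : 'M[R]_n, A \in unitmx &
    E = [set x *m A + c | x in @unit_ball R n].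

Definition ellipsoid (R : realType) (n : nat) (E : set 'rV[R]_n) : Prop :=
  exists c, ellipsoid_centered_at c E.

Definition max_volume_ellipsoid (R : realType) (n : nat)
    (K E : set 'rV[R]_n) : Prop :=
  [/\ ellipsoid E, E `<=` K &
      forall E', ellipsoid E' -> E' `<=` K -> (volume E' <= volume E)%E].

Definition john_ellipsoid (R : realType) (n : nat)
    (K E : set 'rV[R]_n) : Prop :=
  unique (max_volume_ellipsoid K) E.

(* A polytope is a bounded polyhedron: a compact set cut out by finitely many
   linear inequalities [dotp a x <= b], one for each pair (a, b) in s. *)
Definition polytope (R : realType) (n : nat) (P : set 'rV[R]_n) : Prop :=
  compact P /\
  exists s : seq ('rV[R]_n * R),
    P = [set x | forall h, h \in s -> dotp h.1 x <= h.2].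

Definition face (R : realType) (n : nat) (P F : set 'rV[R]_n) : Prop :=
  exists (a : 'rV[R]_n) (b : R),
    (forall x, P x -> dotp a x <= b) /\ F = [set x | P x /\ dotp a x = b].

(* F is nonempty and its affine hull has dimension d: V is the direction of
   the affine hull, i.e. the smallest linear subspace containing F - x0. *)
Definition has_dimension (R : realType) (n : nat) (F : set 'rV[R]_n)
    (d : nat) : Prop :=
  exists (x0 : 'rV[R]_n) (V : {vspace 'rV[R]_n}),
    [/\ F x0,
        forall x, F x -> x - x0 \in V,
        forall W : {vspace 'rV[R]_n},
          (forall x, F x -> x - x0 \in W) -> (V <= W)%VS
      & (\dim V)%VS = d].

Definition facets (R : realType) (n : nat) (P : set 'rV[R]_n) :
    set (set 'rV[R]_n) :=
  [set F | face P F /\ has_dimension F n.-1].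

Definition has_at_least_facets (R : realType) (n : nat) (P : set 'rV[R]_n)
    (x : R) : Prop :=
  exists2 N : nat, x <= N%:R & (`I_N #<= facets P)%card.

(* Main.v *)
Require Import Defs.
From mathcomp Require Import all_boot all_order all_algebra.
From mathcomp Require Import all_classical all_reals all_analysis.
From mathcomp Require Import measurable_realfun ring lra.
Import Order.TTheory GRing.Theory Num.Theory.
Import numFieldNormedType.Exports.
Local Open Scope classical_set_scope.
Local Open Scope ring_scope.

(** Let u_0, ..., u_n be the outer unit normals of the facets of a regular simplex
    circumscribed about the unit ball. The body K is this simplex truncated by
    half-spaces <x, v_B> <= 1 with |v_B| <= 1, one for each member B of a family of
    d-element sets of indices in {1, ..., n}, with d of order n^2 / r^2.

    The unit ball is the John ellipsoid of K because it lies in K and is already the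
    largest ellipsoid of the simplex. Indeed an ellipsoid is the image of the ball
    under a triangular matrix T with positive diagonal, up to a translation
    ([qr_decomposition]); if it lies in the simplex then testing it in the directions
    u_i bounds the trace of T by n, and the inequality of arithmetic and geometric
    means bounds the determinant by 1, with equality only for the ball
    ([simplex_max_det]). Volumes of such images are determinants times the volume of
    the ball, which is seen by slicing along the first coordinate
    ([volume_triangular_image]).

    For the facets, each A in the family has a witness w_A with <w_A, u_j> <= 1 / r
    for all j, <w_A, v_A> > 1, and <w_A, v_B> <= 0 for B <> A. In the barycentric
    coordinates of the simplex, w_A takes the value - 4 / sqrt d on A and -1 at the
    index 0; to have sum zero its other coordinates are of order sqrt d / n, that is,
    of order 1 / r. The vector v_B is a multiple of the negative indicator of B plus a
    contribution at the index 0. That contribution lowers all the products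
    <w_A, v_B> by the same amount, which makes them nonpositive as soon as A and B
    share at most d / 4 elements ([dotp_witness_cut_le0]).

    Suppose now that K <= P <= r K. Since <w_A, v_A> > 1, the point r w_A is not in
    r K, hence some inequality that defines P excludes it. But one valid inequality
    for K excludes at most 3 r of these points, because the average of more than 3 r
    of them lies in K ([few_witnesses_per_halfspace]). So P is not cut out by fewer
    than M / (3 r) half-spaces, where M is the size of the family, and a shortest
    description of P by half-spaces is no longer than its list of facets
    ([polytope_halfspaces_facets]).

    Finally a maximal code in the space of functions from d places to an alphabet of
    size q = n / d provides q ^ (d / 8) sets with the required intersections
    ([sparse_set_family], [code_size]), and q ^ (d / 8) is the bound of the theorem,
    up to the constant in the exponent, since q is at least of order r^2 / n. *)

(** * The Euclidean inner product *)

Lemma dotpE {R : realType} {n : nat} (x y : 'rV[R]_n) : dotp x y = (x *m y^T) 0 0.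
Proof. by rewrite mxE; apply: eq_bigr => i _; rewrite mxE. Qed.

Lemma dotpC {R : realType} {n : nat} (x y : 'rV[R]_n) : dotp x y = dotp y x.
Proof. by apply: eq_bigr => i _; rewrite mulrC. Qed.

Lemma dotpDl {R : realType} {n : nat} (x y z : 'rV[R]_n) :
  dotp (x + y) z = dotp x z + dotp y z.
Proof. by rewrite !dotpE mulmxDl mxE. Qed.

Lemma dotpZl {R : realType} {n : nat} (a : R) (x z : 'rV[R]_n) :
  dotp (a *: x) z = a * dotp x z.
Proof. by rewrite !dotpE -scalemxAl mxE. Qed.

Lemma dotpDr {R : realType} {n : nat} (x y z : 'rV[R]_n) :
  dotp z (x + y) = dotp z x + dotp z y.
Proof. by rewrite !(dotpC z) dotpDl. Qed.

Lemma dotpZr {R : realType} {n : nat} (a : R) (x z : 'rV[R]_n) :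
  dotp z (a *: x) = a * dotp z x.
Proof. by rewrite !(dotpC z) dotpZl. Qed.

Lemma dotpBl {R : realType} {n : nat} (x y z : 'rV[R]_n) :
  dotp (x - y) z = dotp x z - dotp y z.
Proof. by rewrite -scaleN1r dotpDl dotpZl mulN1r. Qed.

Lemma dotpBr {R : realType} {n : nat} (x y z : 'rV[R]_n) :
  dotp z (x - y) = dotp z x - dotp z y.
Proof. by rewrite !(dotpC z) dotpBl. Qed.

Lemma dotp0l {R : realType} {n : nat} (x : 'rV[R]_n) : dotp 0 x = 0.
Proof. by rewrite dotpE mul0mx mxE. Qed.

Lemma dotp0r {R : realType} {n : nat} (x : 'rV[R]_n) : dotp x 0 = 0.
Proof. by rewrite dotpC dotp0l. Qed.

Lemma dotp_suml {R : realType} {n : nat} (I : finType) (P : pred I)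
    (f : I -> 'rV[R]_n) (y : 'rV[R]_n) :
  dotp (\sum_(i | P i) f i) y = \sum_(i | P i) dotp (f i) y.
Proof.
by apply: (big_morph (fun x => dotp x y) (fun x z => dotpDl x z y) (dotp0l y)).
Qed.

Lemma dotp_sumr {R : realType} {n : nat} (I : finType) (P : pred I)
    (f : I -> 'rV[R]_n) (y : 'rV[R]_n) :
  dotp y (\sum_(i | P i) f i) = \sum_(i | P i) dotp y (f i).
Proof. by rewrite dotpC dotp_suml; apply: eq_bigr => i _; rewrite dotpC. Qed.

Lemma dotp_mulmx {R : realType} {m n : nat} (x : 'rV[R]_m) (A : 'M[R]_(m, n))
    (y : 'rV[R]_n) : dotp (x *m A) y = dotp x (y *m A^T).
Proof. by rewrite !dotpE trmx_mul trmxK mulmxA. Qed.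

Lemma dotp_ge0 {R : realType} {n : nat} (x : 'rV[R]_n) : 0 <= dotp x x.
Proof. by apply: sumr_ge0 => i _; rewrite -expr2 sqr_ge0. Qed.

Lemma dotp_eq0 {R : realType} {n : nat} (x : 'rV[R]_n) :
  (dotp x x == 0) = (x == 0).
Proof.
apply/eqP/eqP => [h|->]; last by rewrite dotp0l.
apply/rowP => i; rewrite mxE; apply/eqP; rewrite -sqrf_eq0 expr2; apply/eqP.
by apply: (psumr_eq0P _ h) => // j _; rewrite -expr2 sqr_ge0.
Qed.

Lemma dotp_gt0 {R : realType} {n : nat} (x : 'rV[R]_n) :
  (0 < dotp x x) = (x != 0).
Proof. by rewrite lt_neqAle dotp_ge0 andbT eq_sym dotp_eq0. Qed.

Lemma cauchy_schwarz {R : realType} {n : nat} (x y : 'rV[R]_n) :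
  dotp x y <= Num.sqrt (dotp x x) * Num.sqrt (dotp y y).
Proof.
rewrite -sqrtrM ?dotp_ge0 //.
apply: le_trans (ler_norm _) _; rewrite -sqrtr_sqr ler_wsqrtr //.
have [->|y0] := eqVneq y 0; first by rewrite !dotp0r expr0n mulr0.
have yp : 0 < dotp y y by rewrite dotp_gt0.
have := dotp_ge0 (dotp y y *: x - dotp x y *: y).
rewrite !(dotpBl, dotpBr, dotpZl, dotpZr) (dotpC y x) => h.
by rewrite -subr_ge0 -(pmulr_rge0 _ yp); lra.
Qed.

Lemma in_unit_ball {R : realType} {n : nat} (x : 'rV[R]_n) :
  @unit_ball R n x <-> dotp x x <= 1.
Proof. by rewrite /unit_ball /= -{1}[1]sqrtr1 ler_sqrt. Qed.

(** * Triangular matrices and ellipsoids *)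

(** The positive diagonal is part of the definition: it makes the determinant and
    the trace directly comparable in the inequality of arithmetic and geometric
    means. *)
Definition upper_triangular {R : realType} {n : nat} (T : 'M[R]_n) : Prop :=
  (forall i j : 'I_n, (j < i)%N -> T i j = 0) /\ (forall i, 0 < T i i).

Lemma upper_triangular_det {R : realType} {n : nat} (T : 'M[R]_n) :
  upper_triangular T -> \det T = \prod_(i < n) T i i.
Proof.
move=> [T0 _]; rewrite -det_tr det_trig.
  by apply: eq_bigr => i _; rewrite mxE.
by apply/is_trig_mxP => i j ij; rewrite mxE T0.
Qed.

Lemma upper_triangular_det_gt0 {R : realType} {n : nat} (T : 'M[R]_n) :
  upper_triangular T -> 0 < \det T.
Proof. by move=> hT; rewrite upper_triangular_det // prodr_gt0 // => i _; apply hT. Qed.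

Lemma dotp_row_mx {R : realType} {m n : nat} (x1 x2 : 'rV[R]_m) (y1 y2 : 'rV[R]_n) :
  dotp (row_mx x1 y1) (row_mx x2 y2) = dotp x1 x2 + dotp y1 y2.
Proof. by rewrite !dotpE tr_row_mx mul_row_col mxE. Qed.

Lemma dotp_scalar {R : realType} (s t : R) : dotp (s%:M : 'rV_1) t%:M = s * t.
Proof. by rewrite /dotp big_ord1 !mxE !eqxx. Qed.

Lemma scalar_row1 {R : realType} (x : 'rV[R]_1) : x = (x 0 0)%:M.
Proof. by apply/rowP => i; rewrite ord1 mxE eqxx. Qed.

(** Induction on the dimension: after the first row has been split off, what remains
    is the Schur complement, which is again symmetric and positive definite. *)
Lemma cholesky {R : realType} {n : nat} (M : 'M[R]_n) :
  M^T = M -> (forall x, x != 0 -> 0 < dotp (x *m M) x) ->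
  exists2 T, upper_triangular T & M = T^T *m T.
Proof.
elim: n M => [|m IH].
  move=> M _ _; by exists 0; [split; case | rewrite (flatmx0 M) (flatmx0 (_ *m _))].
rewrite -[m.+1]/(1 + m)%N => M Msym Mpos.
pose a := M (lshift m 0) (lshift m 0); pose b : 'rV_m := ursubmx M; pose M' := drsubmx M.
have Mb : M = block_mx a%:M b b^T M'.
  rewrite -[LHS]submxK; congr block_mx.
    by rewrite [LHS]scalar_row1 !mxE.
  by rewrite /b trmx_ursub Msym.
have M'sym : M'^T = M' by rewrite /M' trmx_drsub Msym.
have a0 : 0 < a.
  have := Mpos (row_mx 1%:M 0); rewrite Mb mul_row_block !mul0mx !addr0 dotp_row_mx.
  rewrite dotp0r addr0 mul1mx dotp_scalar mulr1; apply.
  apply/eqP => /rowP /(_ (lshift m 0)); rewrite row_mxEl !mxE eqxx => /eqP.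
  by rewrite oner_eq0.
pose S := M' - a^-1 *: (b^T *m b).
have [|y y0|T' [T'0 T'p] ST'] := IH S.
- by rewrite /S linearB linearZ /= trmx_mul trmxK M'sym.
- (* the first coordinate that minimizes the quadratic form when the others are y *)
  have := Mpos (row_mx (- (a^-1 * dotp y b))%:M y).
  rewrite Mb mul_row_block dotp_row_mx dotpDl.
  have -> : y *m b^T = (dotp y b)%:M by rewrite [LHS]scalar_row1 dotpE.
  rewrite !mul_scalar_mx !dotpDl !dotpZl !dotp_scalar.
  rewrite /S mulmxBr dotpBl -scalemxAr dotpZl mulmxA.
  have -> : y *m b^T = (dotp y b)%:M by rewrite [LHS]scalar_row1 dotpE.
  rewrite mul_scalar_mx dotpZl (dotpC b y) => h; apply: lt_le_trans (h _) _; last first.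
    by rewrite le_eqVlt; apply/orP; left; apply/eqP; field; rewrite gt_eqF.
  apply: contraNN y0 => /eqP/rowP h0; apply/eqP/rowP => i.
  by have := h0 (rshift 1 i); rewrite row_mxEr !mxE.
have sa0 : 0 < Num.sqrt a by rewrite sqrtr_gt0.
exists (block_mx (Num.sqrt a)%:M ((Num.sqrt a)^-1 *: b) 0 T').
  split=> [i j|i].
    case: (@split_ordP 1 m i) => {}i ->; case: (@split_ordP 1 m j) => {}j ->.
    - by rewrite !ord1.
    - by rewrite ord1 /= ltn0.
    - by rewrite block_mxEdl mxE.
    - by rewrite block_mxEdr /= ltn_add2l => /T'0.
  case: (@split_ordP 1 m i) => {}i ->; rewrite ?block_mxEul ?block_mxEdr //.
  by rewrite ord1 mxE eqxx.
rewrite tr_block_mx mulmx_block !tr_scalar_mx !trmx0 !mulmx0 !mul0mx !addr0.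
rewrite -ST' Mb; congr block_mx.
- by rewrite -scalar_mxM -expr2 sqr_sqrtr // ltW.
- by rewrite mul_scalar_mx scalerA mulfV ?gt_eqF // scale1r.
- by rewrite linearZ /= mul_mx_scalar scalerA mulfV ?gt_eqF // scale1r.
- rewrite [(_ *: b)^T]linearZ /= -scalemxAl -scalemxAr scalerA -invfM -expr2 sqr_sqrtr ?(ltW a0)//.
  by rewrite /S addrC subrK.
Qed.

Lemma unitmx_mulmx_eq0 {R : realType} {n : nat} (A : 'M[R]_n) (x : 'rV[R]_n) :
  A \in unitmx -> (x *m A == 0) = (x == 0).
Proof.
move=> Au; apply/eqP/eqP => [h|->]; last by rewrite mul0mx.
by rewrite -(mulmxK Au x) h mul0mx.
Qed.

Lemma qr_decomposition {R : realType} {n : nat} (A : 'M[R]_n) : A \in unitmx ->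
  exists Q T : 'M[R]_n, [/\ Q *m Q^T = 1%:M, upper_triangular T & A = Q *m T].
Proof.
move=> Au; have [||T Tu AT] := @cholesky R n (A^T *m A).
- by rewrite trmx_mul trmxK.
- move=> x x0; rewrite mulmxA dotp_mulmx dotp_gt0.
  by rewrite unitmx_mulmx_eq0 // unitmx_tr.
have Tunit : T \in unitmx by rewrite unitmxE unitfE gt_eqF ?upper_triangular_det_gt0.
exists (A *m invmx T), T; split => //; last by rewrite mulmxKV.
apply: mulmx1C; rewrite trmx_mul mulmxA -(mulmxA _ A^T A) AT !mulmxA -trmx_mul mulmxV //.
by rewrite trmx1 mul1mx mulmxV.
Qed.

(** The orthogonal factor of a matrix does not change the ellipsoid, so triangular
    matrices describe all ellipsoids. *)
Lemma unit_ball_mul_orthogonal {R : realType} {n : nat} (Q T : 'M[R]_n) (c : 'rV[R]_n) :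
  Q *m Q^T = 1%:M ->
  [set x *m (Q *m T) + c | x in @unit_ball R n] = [set x *m T + c | x in @unit_ball R n].
Proof.
move=> QQ; have QQ' := mulmx1C QQ; apply/seteqP; split => _ [x /in_unit_ball hx <-].
  exists (x *m Q); last by rewrite mulmxA.
  by apply/in_unit_ball; rewrite dotp_mulmx -mulmxA QQ mulmx1.
exists (x *m Q^T); last by rewrite mulmxA -(mulmxA x) QQ' mulmx1.
by apply/in_unit_ball; rewrite dotp_mulmx trmxK -mulmxA QQ' mulmx1.
Qed.

(** * The regular simplex and its largest ellipsoid *)

(** The outer unit normals of the facets of a regular simplex circumscribed
    about the unit ball, described by their Gram matrix and by the two
    identities of John's decomposition. *)
Definition simplex_frame {R : realType} {n : nat} (U : 'I_n.+1 -> 'rV[R]_n) : Prop :=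
  [/\ forall i j, dotp (U i) (U j) = (1 + n%:R^-1) * (i == j)%:R - n%:R^-1,
      \sum_i U i = 0
    & \sum_i (U i)^T *m U i = (1 + n%:R^-1)%:M].

(** The first vector points along the diagonal, the others are the basis vectors
    stretched and shifted along the diagonal; a and b solve the equations given by
    the Gram matrix. *)
Lemma simplex_frame_exists {R : realType} (n : nat) : (0 < n)%N ->
  exists U : 'I_n.+1 -> 'rV[R]_n, simplex_frame U.
Proof.
move=> n0; have nR0 : 0 < n%:R :> R by rewrite ltr0n.
pose s : R := (Num.sqrt n%:R)^-1; pose a : R := Num.sqrt (1 + n%:R^-1).
pose b : R := (s - a) / n%:R.
have s2 : s * s = n%:R^-1 by rewrite -invfM -expr2 sqr_sqrtr // ltW.
have a2 : a * a = 1 + n%:R^-1.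
  by rewrite -expr2 sqr_sqrtr // addr_ge0 // invr_ge0 ltW.
have ab : n%:R * b = s - a by rewrite /b mulrC divfK // gt_eqF.
have nV : n%:R * n%:R^-1 = 1 :> R by rewrite mulfV // gt_eqF.
have q0 : n%:R^-1 + (2 * a * b + n%:R * b * b) = 0.
  rewrite ab; have -> : 2 * a * b + (s - a) * b = b * (s + a) by ring.
  by rewrite /b mulrAC -subr_sqr !expr2 s2 a2; field; rewrite gt_eqF.
pose U (i : 'I_n.+1) : 'rV[R]_n :=
  if unlift ord0 i is Some j then a *: delta_mx 0 j + const_mx b else const_mx (- s).
have U0 : U ord0 = const_mx (- s) by rewrite /U unlift_none.
have US j : U (lift ord0 j) = a *: delta_mx 0 j + const_mx b by rewrite /U liftK.
have dcc x y : dotp (const_mx x : 'rV[R]_n) (const_mx y) = n%:R * (x * y).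
  rewrite /dotp (eq_bigr (fun=> x * y)) => [|i _]; last by rewrite !mxE.
  by rewrite sumr_const card_ord mulr_natl.
have ded j x : dotp (delta_mx 0 j : 'rV[R]_n) x = x 0 j.
  rewrite /dotp (bigD1 j) //= mxE !eqxx mul1r big1 ?addr0 // => i ij.
  by rewrite mxE eqxx (negPf ij) mul0r.
exists U; split.
- move=> i j; case: (unliftP ord0 i) => [i'|] ->; case: (unliftP ord0 j) => [j'|] ->.
  + rewrite !US !(dotpDl, dotpDr, dotpZl, dotpZr) dcc (dotpC (const_mx b)) !ded !mxE eqxx.
    rewrite (inj_eq lift_inj) andTb eq_sym -a2.
    have -> : n%:R^-1 = - (2 * a * b + n%:R * b * b) by lra.
    ring.
  + rewrite US U0 dotpDl dotpZl dcc ded mxE eq_sym (negPf (neq_lift _ _)) mulr0 add0r.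
    have -> : n%:R * (b * - s) = - s * (n%:R * b) by ring.
    by rewrite ab -s2; ring.
  + rewrite US U0 dotpC dotpDl dotpZl dcc ded mxE (negPf (neq_lift _ _)) mulr0 add0r.
    have -> : n%:R * (b * - s) = - s * (n%:R * b) by ring.
    by rewrite ab -s2; ring.
  + by rewrite U0 dcc eqxx mulrNN s2 nV mulr1 addrK.
- apply/rowP => k; rewrite summxE big_ord_recl U0 !mxE.
  under eq_bigr do rewrite US !mxE eqxx andTb.
  rewrite big_split /= sumr_const card_ord -mulr_natl ab (bigD1 k) //= eqxx mulr1.
  rewrite big1 => [|i]; first by ring.
  by rewrite eq_sym => /negPf ->; rewrite mulr0.
- apply/matrixP => k l; rewrite summxE big_ord_recl U0.
  under eq_bigr do rewrite US.
  rewrite !mxE big_ord1 !mxE mulrNN s2.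
  rewrite (eq_bigr (fun i => (a * a) * ((k == i)%:R * (l == i)%:R) + (a * b) * (k == i)%:R
       + (a * b) * (l == i)%:R + b * b)) => [|i _]; last first.
    by rewrite !mxE big_ord1 !mxE !eqxx !andTb; ring.
  have sd (j : 'I_n) : \sum_(i < n) (j == i)%:R = 1 :> R.
    by rewrite (bigD1 j) //= eqxx big1 ?addr0 // => i; rewrite eq_sym => /negPf ->.
  rewrite !big_split /= sumr_const card_ord -!mulr_sumr !sd.
  rewrite (bigD1 k) //= eqxx big1 => [|i]; last first.
    by rewrite eq_sym => /negPf ->; rewrite mul0r.
  by rewrite a2 (eq_sym l k) -mulr_natl; case: (k == l); rewrite /=; lra.
Qed.

Lemma frame_isotropy {R : realType} {n : nat} (U : 'I_n.+1 -> 'rV[R]_n) (x : 'rV[R]_n) :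
  simplex_frame U -> \sum_i dotp x (U i) *: U i = (1 + n%:R^-1) *: x.
Proof.
move=> [_ _ h]; rewrite -mul_mx_scalar -h mulmx_sumr; apply: eq_bigr => i _.
by rewrite mulmxA [x *m _]scalar_row1 -dotpE mul_scalar_mx.
Qed.

Lemma frame_dotp {R : realType} {n : nat} (U : 'I_n.+1 -> 'rV[R]_n) (x : 'rV[R]_n) :
  simplex_frame U -> \sum_i dotp x (U i) = 0.
Proof. by move=> [_ h _]; rewrite -dotp_sumr h dotp0r. Qed.

Lemma frame_trace {R : realType} {n : nat} (U : 'I_n.+1 -> 'rV[R]_n) (T : 'M[R]_n) :
  simplex_frame U -> \sum_i dotp (U i *m T) (U i) = (1 + n%:R^-1) * \tr T.
Proof.
move=> [_ _ h]; rewrite -mxtraceZ -mul_scalar_mx -h mulmx_suml raddf_sum /=.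
apply: eq_bigr => i _; rewrite dotpE -[in RHS]mulmxA mxtrace_mulC.
by rewrite [RHS]/mxtrace big_ord1.
Qed.

Lemma frame_norm {R : realType} {n : nat} (U : 'I_n.+1 -> 'rV[R]_n) i :
  simplex_frame U -> dotp (U i) (U i) = 1.
Proof. by move=> [h _ _]; rewrite h eqxx mulr1 addrK. Qed.

(** Testing the ellipsoid at the point where a linear functional is largest. *)
Lemma ellipsoid_support {R : realType} {n : nat} (T : 'M[R]_n) (c u : 'rV[R]_n) (b : R) :
  (forall x, dotp x x <= 1 -> dotp (x *m T + c) u <= b) ->
  Num.sqrt (dotp (u *m T^T) (u *m T^T)) + dotp c u <= b.
Proof.
move=> h; set y := u *m T^T; set r := Num.sqrt _.
have [y0|y0] := eqVneq y 0.
  have := h 0; rewrite dotp0l ler01 mul0mx add0r => /(_ isT).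
  by rewrite /r y0 dotp0l sqrtr0 add0r.
have r0 : 0 < r by rewrite sqrtr_gt0 dotp_gt0.
have r2 : dotp y y = r * r by rewrite -expr2 sqr_sqrtr // dotp_ge0.
have := h (r^-1 *: y); rewrite dotpDl dotp_mulmx -/y !(dotpZl, dotpZr) r2.
by rewrite mulKf ?gt_eqF // mulVf ?gt_eqF // lexx => /(_ isT).
Qed.

(** The support function of the ellipsoid in the direction U i is at least the
    diagonal entry <U i, U i T^T> (Cauchy-Schwarz), and these sum up to the trace of
    T; so the trace is at most n, and the inequality of arithmetic and geometric
    means bounds the determinant. In the case of equality all the U i are
    eigenvectors, and as they satisfy only one linear relation their eigenvalues
    coincide. *)
Lemma simplex_max_det {R : realType} {n : nat} (U : 'I_n.+1 -> 'rV[R]_n) (T : 'M[R]_n)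
    (c : 'rV[R]_n) : (0 < n)%N -> simplex_frame U -> upper_triangular T ->
  (forall i x, dotp x x <= 1 -> dotp (x *m T + c) (U i) <= 1) ->
  \det T <= 1 /\ (1 <= \det T -> T = 1%:M /\ c = 0).
Proof.
move=> n0 fU Tu hE; have nR0 : 0 < n%:R :> R by rewrite ltr0n.
pose h i := Num.sqrt (dotp (U i *m T^T) (U i *m T^T)).
pose l i := dotp (U i *m T^T) (U i).
have k0 : 0 < 1 + n%:R^-1 :> R by rewrite addr_gt0 // invr_gt0.
have hc i : h i + dotp c (U i) <= 1 by apply: ellipsoid_support => x; exact: hE.
have lh i : l i <= h i.
  by apply: le_trans (cauchy_schwarz _ _) _; rewrite frame_norm // sqrtr1 mulr1.
have suml : \sum_i l i = (1 + n%:R^-1) * \tr T by rewrite frame_trace // mxtrace_tr.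
have sumh : \sum_i h i <= (1 + n%:R^-1) * n%:R.
  have : \sum_i (h i + dotp c (U i)) <= \sum_(i < n.+1) 1 by apply: ler_sum.
  rewrite big_split /= frame_dotp // addr0 sumr_const card_ord.
  by rewrite mulrDl mul1r mulVf ?gt_eqF // natr1.
have trn : \tr T <= n%:R.
  by rewrite -(ler_pM2l k0) -suml; apply: le_trans sumh; apply: ler_sum.
have tr0 : 0 <= \tr T by apply: sumr_ge0 => i _; rewrite ltW //; apply Tu.
have amgm : \det T <= (\tr T / n%:R) ^+ n.
  rewrite upper_triangular_det //.
  have := @leif_AGM R 'I_n predT (fun i => T i i) _.
  rewrite card_ord => /(_ _)[|+ _]; last exact.
  by move=> i _; rewrite ltW //; apply Tu.
have mean1 : \tr T / n%:R <= 1 by rewrite ler_pdivrMr // mul1r.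
have mean0 : 0 <= \tr T / n%:R by rewrite divr_ge0 // ltW.
split; first by apply: le_trans amgm _; rewrite exprn_ile1.
move=> det1; have trE : \tr T = n%:R.
  apply/eqP; rewrite eq_le trn /= -[X in X <= _]mul1r -ler_pdivlMr // leNgt.
  apply/negP => mlt; suff : (\tr T / n%:R) ^+ n < 1 by rewrite ltNge (le_trans det1 amgm).
  by rewrite expr_lt1.
have hl i : h i = l i.
  have s0 : \sum_i (h i - l i) = 0.
    apply/eqP; rewrite eq_le sumr_ge0 => [|j _]; last by rewrite subr_ge0.
    by rewrite sumrB suml trE subr_le0 sumh.
  by apply/eqP; rewrite -subr_eq0; apply/eqP/(psumr_eq0P _ s0) => // j _; rewrite subr_ge0.
have eig i : U i *m T^T = l i *: U i.
  apply/eqP; rewrite -subr_eq0 -dotp_eq0; apply/eqP.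
  rewrite !(dotpBl, dotpBr, dotpZl, dotpZr) frame_norm // (dotpC (U i)) -/(l i).
  have -> : dotp (U i *m T^T) (U i *m T^T) = l i * l i.
    by rewrite -hl -expr2 sqr_sqrtr // dotp_ge0.
  ring.
have l1 j : l j = 1.
  have [g sU _] := fU.
  have : dotp (\sum_i l i *: U i) (U j) = 0.
    under eq_bigr do rewrite -eig.
    by rewrite -mulmx_suml sU mul0mx dotp0l.
  rewrite dotp_suml; under eq_bigr do rewrite dotpZl g mulrBr.
  rewrite sumrB -mulr_suml suml trE (bigD1 j) //= eqxx big1 => [|i /negPf ->]; last first.
    by rewrite !mulr0.
  rewrite addr0 mulr1 -mulrA mulfV ?gt_eqF // mulr1 => /eqP.
  by rewrite -{2}[1 + _]mul1r -mulrBl mulf_eq0 (gt_eqF k0) orbF subr_eq0 => /eqP.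
have kI (x y : 'M[R]_n) : (1 + n%:R^-1) *: x = (1 + n%:R^-1) *: y -> x = y.
  by apply: scalerI; rewrite gt_eqF.
split.
  apply: trmx_inj; rewrite trmx1; apply: kI; rewrite -mul_scalar_mx.
  have [_ _ iso] := fU; rewrite -{1}iso mulmx_suml scalemx1 -iso.
  by apply: eq_bigr => i _; rewrite -mulmxA eig l1 scale1r.
have cle i : dotp c (U i) <= 0 by have := hc i; rewrite hl l1; lra.
have c0 i : dotp c (U i) = 0.
  apply/eqP; rewrite -oppr_eq0; apply/eqP.
  have s0 : \sum_i - dotp c (U i) = 0 by rewrite sumrN frame_dotp // oppr0.
  by apply: (psumr_eq0P _ s0) => // j _; rewrite oppr_ge0.
apply: (@scalerI _ _ (1 + n%:R^-1)); first by rewrite gt_eqF.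
rewrite -(frame_isotropy _ _ fU) scaler0 big1 // => i _; by rewrite c0 scale0r.
Qed.

(** * Volumes of ellipsoids *)

(** Both sides integrate f against the same measure: by uniqueness of the Lebesgue
    measure, its image under the affine map, divided by a, is the Lebesgue measure. *)
Lemma ge0_integral_affine {R : realType} (a c : R) (f : R -> \bar R) : 0 < a ->
  measurable_fun [set: R] f -> (forall x, 0 <= f x)%E ->
  (\int[lebesgue_measure]_t f ((t - c) / a)%R = a%:E * \int[lebesgue_measure]_t f t)%E.
Proof.
move=> a0 mf f0.
pose phi (t : measurableTypeR R) : measurableTypeR R := (t - c) / a.
have mphi : measurable_fun setT phi.
  by apply: measurable_funM => //; apply: measurable_funB.
have aV0 : 0 <= a^-1 by rewrite invr_ge0 ltW.
(* the tactic supplies the measurability of phi, on which the structure of measure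
   of the image depends *)
pose nu : {measure set measurableTypeR R -> \bar R} :=
  ltac:(refine (mscale (NngNum aV0) (pushforward (@lebesgue_measure R) phi)); exact: mphi).
have nuE A : measurable A -> lebesgue_measure A = nu A.
  apply: lebesgue_measure_unique => _ [[x y]] _ <-.
  change (nu _) with (a^-1%:E * lebesgue_measure (phi @^-1` `]x, y]%classic))%E.
  have -> : phi @^-1` `]x, y]%classic = `]a * x + c, a * y + c]%classic.
    apply/seteqP; split => t /=; rewrite /phi !in_itv /= ltr_pdivlMr // ler_pdivrMr //;
      by rewrite ltrBrDr lerBlDr !(mulrC a).
  rewrite !lebesgue_measure_itv /= !lte_fin ltrD2r ltr_pM2l //.
  case: ifP => _; last by rewrite mule0.
  by rewrite -!EFinD -EFinM; congr EFin; field; rewrite gt_eqF.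
have -> : (\int[lebesgue_measure]_t f t = \int[nu]_t f t)%E.
  by apply: eq_measure_integral => A mA _; exact: nuE.
rewrite ge0_integral_mscale //= ge0_integral_pushforward // muleA -EFinM mulfV ?gt_eqF //.
by rewrite mul1e.
Qed.

(** The volume of the ball of squared radius rho, sliced along the first
    coordinate. Indexing by the squared radius makes every slice of a ball again
    a ball of the family, empty when rho is negative. *)
Fixpoint ball_volume {R : realType} (n : nat) (rho : R) : \bar R :=
  match n with
  | 0 => (if 0 <= rho then 1 else 0)%:E
  | m.+1 => (\int[lebesgue_measure]_s ball_volume m (rho - s ^+ 2)%R)%E
  end.

Lemma nondecreasing_emeasurable {R : realType} (f : R -> \bar R) :
  (forall x, f x \is a fin_num) -> (forall x y, x <= y -> (f x <= f y)%E) ->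
  measurable_fun [set: R] f.
Proof.
move=> ff fm; have -> : f = EFin \o (fine \o f) by apply/funext => x /=; rewrite fineK.
apply/measurable_EFinP; apply: nondecreasing_measurable => // x y xy /=.
by rewrite fine_le // fm.
Qed.

Lemma measurable_slice {R : realType} (f : R -> \bar R) (rho : R) :
  measurable_fun [set: R] f -> measurable_fun [set: R] (fun s => f (rho - s ^+ 2)).
Proof.
move=> mf; apply: (measurableT_comp mf).
by apply: measurable_funB => //; exact: measurable_funX.
Qed.

Lemma integral_scaled_indic {R : realType} (k : R) (A : set R) : 0 <= k ->
  measurable A ->
  (\int[lebesgue_measure]_s (k * \1_A s)%:E = k%:E * @lebesgue_measure R A)%E.
Proof.
move=> k0 mA; under eq_integral do rewrite EFinM.
rewrite ge0_integralZl_EFin //; first by rewrite integral_indic // setIT.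
by apply/measurable_EFinP; exact: measurable_indic.
Qed.

(** Monotonicity in the squared radius comes together with the other properties in
    one induction, since it is what makes the slices measurable. *)
Lemma ball_volumeP {R : realType} (n : nat) :
  [/\ forall rho : R, ball_volume n rho \is a fin_num,
      forall rho : R, (0 <= ball_volume n rho)%E,
      forall rho : R, rho < 0 -> ball_volume n rho = 0%E,
      forall rho rho' : R, rho <= rho' -> (ball_volume n rho <= ball_volume n rho')%E
    & forall rho : R, 0 < rho -> (0 < ball_volume n rho)%E].
Proof.
elim: n => [|n [IHf IH0 IHn IHm IHp]] /=.
  split=> // rho.
  - by rewrite lee_fin; case: ifP.
  - by move=> r0; rewrite leNgt r0.
  - move=> rho' h; rewrite lee_fin; case: ifP => [r0|_]; last by case: ifP.
    by rewrite (le_trans r0 h).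
  - by move=> r0; rewrite (ltW r0).
have mG (rho : R) : measurable_fun [set: R] (fun s => ball_volume n (rho - s ^+ 2)).
  by apply: measurable_slice; exact: nondecreasing_emeasurable.
have ge0 (rho : R) : (0 <= \int[lebesgue_measure]_s ball_volume n (rho - s ^+ 2)%R)%E.
  exact: integral_ge0.
split=> // rho.
- (* the slices outside of [-a, a] are empty, as rho < (1 + |rho|)^2 *)
  rewrite ge0_fin_numE //; pose a := 1 + `|rho|.
  have a0 : 0 < a by rewrite ltr_pwDl.
  pose k := fine (ball_volume n rho).
  have k0 : 0 <= k by rewrite fine_ge0.
  apply: (@le_lt_trans _ _ (\int[lebesgue_measure]_s (k * \1_(`[- a, a]%classic) s)%:E)%E).
    apply: ge0_le_integral => //; first exact: mG.
      by apply/measurable_EFinP; apply: measurable_funM.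
    move=> s _; rewrite indicE; case: (boolP (s \in _)) => [_|sa].
      by rewrite mulr1 fineK //; apply: IHm; rewrite gerBl sqr_ge0.
    rewrite mulr0 IHn // subr_lt0; apply: (@lt_le_trans _ _ (a ^+ 2)).
      apply: le_lt_trans (ler_norm _) _; rewrite /a sqrrD expr1n mul1r.
      have := normr_ge0 rho; have := sqr_ge0 `|rho|; lra.
    have sa' : a < `|s|.
      by rewrite ltNge; apply: contraNN sa => sa; rewrite inE /= in_itv /= -ler_norml.
    rewrite -[s ^+ 2]real_normK ?num_real //.
    by rewrite lerXn2r ?nnegrE ?normr_ge0 ?(ltW a0) ?(ltW sa').
  rewrite integral_scaled_indic // lebesgue_measure_itv /=.
  by case: ifP => _; rewrite -?EFinD -?EFinM ?mule0 ltry.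
- move=> r0; apply: integral0_eq => s _; apply: IHn.
  by rewrite subr_lt0 (lt_le_trans r0) // sqr_ge0.
- move=> rho' h; apply: ge0_le_integral => //; [exact: mG | exact: mG |].
  by move=> s _; apply: IHm; rewrite lerB.
- (* for 0 <= s <= b the slice at s has squared radius at least rho / 2 *)
  move=> r0; pose b := Num.min 1 (rho / 2).
  have b0 : 0 < b by rewrite lt_min ltr01 divr_gt0.
  pose k := fine (ball_volume n (rho / 2)).
  have k0 : 0 < k.
    by rewrite fine_gt0 // IHp ?divr_gt0 //= -ge0_fin_numE.
  apply: (@lt_le_trans _ _ (\int[lebesgue_measure]_s (k * \1_(`[0, b]%classic) s)%:E)%E).
    rewrite integral_scaled_indic ?ltW // lebesgue_measure_itv /= lte_fin b0.
    by rewrite oppr0 adde0 -EFinM lte_fin mulr_gt0.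
  apply: ge0_le_integral => //.
  + by move=> s _; rewrite lee_fin mulr_ge0 // ltW.
  + by apply/measurable_EFinP; apply: measurable_funM.
  + exact: mG.
  + move=> s _; rewrite indicE; case: (boolP (s \in _)) => [|_]; last by rewrite mulr0.
    rewrite inE /= in_itv /= => /andP[s0]; rewrite le_min => /andP[s1 s2].
    rewrite mulr1 fineK //; apply: IHm.
    have : s ^+ 2 <= s by rewrite expr2 ler_piMr.
    lra.
Qed.

Lemma measurable_ball_volume {R : realType} (n : nat) :
  measurable_fun [set: R] (ball_volume n).
Proof. by have [hf _ _ hm _] := @ball_volumeP R n; exact: nondecreasing_emeasurable. Qed.

(** The slice of the image at a given first coordinate is the image of a slice of the
    ball under the lower right block, so induction applies; a general matrix would
    not respect the slices. *)
Lemma volume_triangular_image {R : realType} {n : nat} (T : 'M[R]_n) (c : 'rV[R]_n)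
    (rho : R) : upper_triangular T ->
  volume [set x *m T + c | x in [set x | dotp x x <= rho]] =
  ((\det T)%:E * ball_volume n rho)%E.
Proof.
elim: n T c rho => [|n IH].
  move=> T c rho _; rewrite /= det_mx00 mul1e indicE; congr EFin.
  case: ifP => r0.
    by rewrite mem_set //; exists 0; [rewrite /= dotp0l | rewrite [LHS]thinmx0].
  rewrite memNset // => -[x /= xr _]; move: xr.
  by rewrite (thinmx0 x) dotp0l r0.
rewrite -[n.+1]/(1 + n)%N => T c rho [T0 Tp].
pose a := T (lshift n 0) (lshift n 0); pose r : 'rV_n := ursubmx T; pose T' := drsubmx T.
have TE : T = block_mx a%:M r 0 T'.
  rewrite -[LHS]submxK; congr block_mx; first by rewrite [LHS]scalar_row1 !mxE.
  by apply/matrixP => i j; rewrite !mxE T0 // ord1.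
have T'u : upper_triangular T'.
  split=> [i j ij|i]; last by rewrite !mxE Tp.
  by rewrite !mxE T0 //= ltn_add2l.
have a0 : 0 < a by rewrite Tp.
have detT : \det T = a * \det T' by rewrite TE det_ublock det_scalar1.
pose c1 := c 0 (lshift n 0); pose c2 : 'rV_n := rsubmx c.
have cE : c = row_mx c1%:M c2.
  by rewrite -[LHS]hsubmxK; congr row_mx; rewrite [LHS]scalar_row1 mxE.
have [hf h0 _ _ _] := @ball_volumeP R n.
have imgE s z : row_mx s%:M z *m T + c = row_mx (s * a + c1)%:M (z *m T' + (s *: r + c2)).
  rewrite TE cE mul_row_block !mulmx0 !addr0 !mul_scalar_mx add_row_mx; congr row_mx.
    by rewrite scale_scalar_mx -raddfD.
  by rewrite addrCA addrA.
transitivity (\int[lebesgue_measure]_t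
    ((\det T')%:E * ball_volume n (rho - ((t - c1) / a) ^+ 2)%R))%E.
  rewrite /=; apply: eq_integral => t _; rewrite -(IH _ (((t - c1) / a) *: r + c2)) //.
  congr volume; apply/seteqP; split => y /=.
    move=> [x xr]; rewrite -[x]hsubmxK [lsubmx x]scalar_row1 in xr *.
    move: (lsubmx x 0 0) (rsubmx x) xr => s z.
    rewrite dotp_row_mx dotp_scalar imgE => xr /eq_row_mx[/matrixP/(_ 0 0)].
    rewrite !mxE !eqxx !mulr1n => <- <-; exists z; rewrite addrK mulfK ?gt_eqF //.
    by rewrite lerBrDl.
  move=> [z zr <-]; exists (row_mx ((t - c1) / a)%:M z).
    by rewrite dotp_row_mx dotp_scalar -lerBrDl.
  by rewrite imgE divfK ?gt_eqF // subrK.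
have mB := @measurable_ball_volume R n.
have msl := measurable_slice _ rho mB.
have det0 : 0 <= \det T' by rewrite ltW // upper_triangular_det_gt0.
rewrite (ge0_integral_affine a c1 (fun s => ((\det T')%:E * ball_volume n (rho - s ^+ 2)%R)%E)) //.
- rewrite ge0_integralZl_EFin //= detT EFinM muleA //.
- by apply: emeasurable_funM => //; exact: measurable_cst.
- by move=> x; rewrite mule_ge0.
Qed.

(** The unit ball has positive finite volume, so volumes of ellipsoids compare
    as determinants. *)
Lemma volume_ellipsoid {R : realType} {n : nat} : exists2 k : R, 0 < k &
  forall (T : 'M[R]_n) (c : 'rV[R]_n), upper_triangular T ->
    volume [set x *m T + c | x in @unit_ball R n] = (\det T * k)%:E.
Proof.
have [hf h0 _ _ hp] := @ball_volumeP R n.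
exists (fine (ball_volume n 1)).
  by rewrite fine_gt0 // hp //= -ge0_fin_numE.
move=> T c Tu; have -> : @unit_ball R n = [set x | dotp x x <= 1].
  by apply/seteqP; split => x /in_unit_ball.
by rewrite volume_triangular_image // EFinM fineK.
Qed.

(** * Half-spaces and facets *)

Definition halfspaces {R : realType} {n : nat} (s : seq ('rV[R]_n * R)) : set 'rV[R]_n :=
  [set x | forall h, h \in s -> dotp h.1 x <= h.2].

Lemma minimal_halfspaces {R : realType} {n : nat} (P : set 'rV[R]_n)
    (s0 : seq ('rV[R]_n * R)) : P = halfspaces s0 ->
  exists s, P = halfspaces s /\ forall s', P = halfspaces s' -> (size s <= size s')%N.
Proof.
move=> Ps0; pose p := [pred k | `[< exists s, P = halfspaces s /\ size s = k >]].
have exp : exists k, p k by exists (size s0); apply/asboolP; exists s0.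
case: (ex_minnP exp) => k /asboolP[s [Ps sk]] kmin; exists s; split=> // s' Ps'.
by rewrite sk; apply: kmin; apply/asboolP; exists s'.
Qed.

(** In a shortest description each inequality excludes a point that all the
    others admit. *)
Lemma minimal_halfspaces_irredundant {R : realType} {n : nat} (s : seq ('rV[R]_n * R)) :
  (forall s', halfspaces s = halfspaces s' -> (size s <= size s')%N) ->
  uniq s /\ forall h, h \in s ->
    exists z, h.2 < dotp h.1 z /\ forall h', h' \in s -> h' != h -> dotp h'.1 z <= h'.2.
Proof.
move=> smin; split.
  rewrite -[uniq s]negbK -ltn_size_undup -leqNgt; apply: smin.
  by apply/seteqP; split => x hx h hs; apply: hx; rewrite mem_undup in hs *.
move=> h hs; apply: contrapT => nz.
have := smin [seq h' <- s | h' != h]; rewrite leqNgt => smin'.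
have : (size [seq h' <- s | h' != h] < size s)%N.
  rewrite size_filter -(count_predC (fun h' => h' != h) s) -[X in (X < _)%N]addn0 ltn_add2l.
  by rewrite -has_count; apply/hasP; exists h => //=; rewrite negbK.
apply/negP/smin'; apply/seteqP; split => x hx h'.
  by rewrite mem_filter => /andP[_]; exact: hx.
move=> h's; have [->|h'h] := eqVneq h' h; last by apply: hx; rewrite mem_filter h'h.
rewrite leNgt; apply/negP => hlt; apply: nz; exists x; split=> // h'' h''s h''h.
by apply: hx; rewrite mem_filter h''h.
Qed.

Lemma unit_ball_halfspaces {R : realType} {n : nat} (s : seq ('rV[R]_n * R)) :
  @unit_ball R n `<=` halfspaces s ->
  forall h, h \in s -> Num.sqrt (dotp h.1 h.1) <= h.2.
Proof.
move=> sB h hs; have := @ellipsoid_support R n 1%:M 0 h.1 h.2.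
rewrite trmx1 mulmx1 dotp0l addr0; apply=> x x1.
by rewrite mulmx1 addr0 dotpC; apply: sB => //; apply/in_unit_ball.
Qed.

(** The point is where the segment from the origin to an excluded point leaves
    the half-space of h. *)
Lemma irredundant_facet_point {R : realType} {n : nat} (s : seq ('rV[R]_n * R)) :
  (forall s', halfspaces s = halfspaces s' -> (size s <= size s')%N) ->
  @unit_ball R n `<=` halfspaces s ->
  forall h, h \in s -> h.1 != 0 /\
    exists x, dotp h.1 x = h.2 /\ forall h', h' \in s -> h' != h -> dotp h'.1 x < h'.2.
Proof.
move=> smin sB; have [_ irr] := minimal_halfspaces_irredundant _ smin.
have hB := unit_ball_halfspaces _ sB.
have n0 h : h \in s -> h.1 != 0.
  move=> hs; have [z [hz _]] := irr h hs; apply: contraTneq hz => h0.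
  rewrite h0 dotp0l -leNgt; apply: le_trans (hB h hs); exact: sqrtr_ge0.
have b0 h : h \in s -> 0 < h.2.
  by move=> hs; apply: lt_le_trans (hB h hs); rewrite sqrtr_gt0 dotp_gt0 n0.
move=> h hs; split; first exact: n0.
have [z [hz oz]] := irr h hs; have bh := b0 h hs.
have d0 : 0 < dotp h.1 z by exact: lt_trans hz.
have t1 : h.2 / dotp h.1 z < 1 by rewrite ltr_pdivrMr // mul1r.
have t0 : 0 < h.2 / dotp h.1 z by rewrite divr_gt0.
exists ((h.2 / dotp h.1 z) *: z); split; first by rewrite dotpZr divfK // gt_eqF.
move=> h' h's h'h; rewrite dotpZr; have bh' := b0 h' h's; have := oz h' h's h'h => ozh.
have [dn|dp] := leP (dotp h'.1 z) 0.
  by apply: le_lt_trans bh'; rewrite pmulr_rle0.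
by apply: lt_le_trans ozh; rewrite gtr_pMl.
Qed.

(** Used to move within a hyperplane from a point where all the other inequalities
    are strict. *)
Lemma common_step {R : realType} {T : eqType} (s : seq T) (f g : T -> R) :
  (forall h, h \in s -> 0 < g h) ->
  exists2 e, 0 < e & forall h, h \in s -> e * f h <= g h.
Proof.
elim: s => [|h s IH] gp; first by exists 1.
have [|e e0 he] := IH; first by move=> k ks; apply: gp; rewrite in_cons ks orbT.
have gh : 0 < g h by apply: gp; rewrite mem_head.
have f1 : 0 < 1 + `|f h| by rewrite ltr_pwDl.
exists (Num.min e (g h / (1 + `|f h|))); first by rewrite lt_min e0 divr_gt0.
set m := Num.min _ _; have m0 : 0 <= m by rewrite le_min (ltW e0) divr_ge0 // ltW.
move=> k; rewrite in_cons => /orP[/eqP->|ks].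
  apply: (@le_trans _ _ (m * (1 + `|f h|))).
    by apply: ler_wpM2l => //; have := ler_norm (f h); lra.
  by rewrite -ler_pdivlMr // ge_min lexx orbT.
have [fk|fk] := leP (f k) 0.
  by apply: (@le_trans _ _ 0); [rewrite mulr_ge0_le0 | rewrite ltW // gp // in_cons ks orbT].
by apply: le_trans (he k ks); rewrite ler_pM2r // ge_min lexx.
Qed.

(** The direction of the affine hull of F is the kernel of the linear form of a, which
    has dimension n - 1 because the form does not vanish at a. *)
Lemma hyperplane_has_dimension {R : realType} {n : nat} (a x0 : 'rV[R]_n)
    (F : set 'rV[R]_n) : a != 0 -> F x0 ->
  (forall x, F x -> dotp a x = dotp a x0) ->
  (forall v, dotp a v = 0 -> exists2 e, 0 < e & F (x0 + e *: v)) ->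
  has_dimension F n.-1.
Proof.
move=> a0 Fx0 Fa Fv; pose f := linfun (mulmxr a^T : 'rV[R]_n -> 'rV[R]_1).
have fE v : f v = (dotp a v)%:M by rewrite lfunE /= [LHS]scalar_row1 dotpC dotpE.
have kerE v : (v \in lker f) = (dotp a v == 0).
  rewrite memv_ker fE; apply/eqP/eqP => [/matrixP/(_ 0 0)|->]; last by rewrite raddf0.
  by rewrite !mxE eqxx.
exists x0, (lker f); split => //.
- by move=> x /Fa h; rewrite kerE dotpBr h subrr.
- move=> W hW; apply/subvP => v; rewrite kerE => /eqP /Fv[e e0 /hW].
  rewrite addrC addKr => eW.
  by rewrite -[v]scale1r -(mulVf (lt0r_neq0 e0)) -scalerA memvZ.
- have := limg_ker_dim f fullv; rewrite capfv dimvf dim_matrix mul1r.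
  suff -> : \dim (limg f) = 1%N by rewrite addn1 => /(congr1 predn).
  apply/eqP; rewrite eqn_leq; apply/andP; split.
    by apply: leq_trans (dimvS (subvf _)) _; rewrite dimvf dim_matrix.
  rewrite lt0n dimv_eq0; apply: contraNneq a0 => l0.
  have : f a \in limg f by rewrite memv_img // memvf.
  rewrite l0 memv0 fE => /eqP/matrixP/(_ 0 0); rewrite !mxE eqxx mulr1n => /eqP.
  by rewrite dotp_eq0.
Qed.

(** In a shortest description the inequalities correspond to distinct facets: each
    of them is tight, and strictly so for it alone, at the point given by
    [irredundant_facet_point]. *)
Lemma polytope_halfspaces_facets {R : realType} {n : nat} (P : set 'rV[R]_n) :
  polytope P -> @unit_ball R n `<=` P ->
  exists2 s, P = halfspaces s & (`I_(size s) #<= facets P)%card.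
Proof.
move=> [_ [s0 Ps0]] PB; have [s [Ps smin]] := minimal_halfspaces _ s0 Ps0.
exists s => //; rewrite Ps in smin PB.
have [suniq _] := minimal_halfspaces_irredundant _ smin.
have pt := irredundant_facet_point _ smin PB.
pose F (h : 'rV[R]_n * R) := [set x | P x /\ dotp h.1 x = h.2].
have PF h x : h \in s -> dotp h.1 x = h.2 ->
    (forall h', h' \in s -> h' != h -> dotp h'.1 x <= h'.2) -> F h x.
  move=> hs hx ox; split=> //; rewrite Ps => h' h's.
  by have [->|h'h] := eqVneq h' h; [rewrite hx | exact: ox].
have Ffacet h : h \in s -> facets P (F h).
  move=> hs; split.
    by exists h.1, h.2; split=> // x; rewrite Ps => Px; exact: Px.
  have [h0 [x [hx ox]]] := pt h hs.
  apply: (hyperplane_has_dimension h.1 x) => //.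
  - by apply: PF => // h' h's h'h; rewrite ltW // ox.
  - by move=> y [_ ->].
  - move=> v av; have [|e e0 he] := @common_step R _ [seq h' <- s | h' != h]
        (fun h' => dotp h'.1 v) (fun h' => h'.2 - dotp h'.1 x).
      by move=> h'; rewrite mem_filter subr_gt0 => /andP[h'h /ox]; exact.
    exists e => //; apply: PF => //; first by rewrite dotpDr dotpZr av mulr0 addr0.
    move=> h' h's h'h; rewrite dotpDr dotpZr addrC -lerBrDr; apply: he.
    by rewrite mem_filter h'h.
have Finj h h' : h \in s -> h' \in s -> F h = F h' -> h = h'.
  move=> hs h's FE; apply/eqP; apply: contraT => hh'.
  have [_ [x [hx ox]]] := pt h hs.
  have : F h x by apply: PF => // k ks kh; rewrite ltW // ox.
  rewrite FE => -[_ h'x]; have := ox h' h's; rewrite h'x ltxx eq_sym => /(_ hh').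
  by [].
pose d : 'rV[R]_n * R := (0, 0).
have inj : {in `I_(size s) &, injective (fun i => F (nth d s i))}.
  move=> i j; rewrite !inE /= => hi hj /Finj H; apply/eqP; rewrite -(nth_uniq d hi hj) //.
  by apply/eqP; apply: H; exact: mem_nth.
rewrite -(card_le_eql (inj_card_eq inj)); apply: subset_card_le => _ [i /= hi <-].
by apply: Ffacet; exact: mem_nth.
Qed.

(** * Families of sets with small intersections *)

Lemma card_bigcup_leq {I T : finType} (P : pred I) (A : I -> {set T}) :
  (#|(\bigcup_(i | P i) A i)%SET| <= \sum_(i | P i) #|A i|)%N.
Proof.
elim/big_rec2: _ => [|i m B _ h]; first by rewrite cards0.
by apply: leq_trans (leq_card_setU _ _) _; rewrite leq_add2l.
Qed.

Definition agreement {d q : nat} (f g : {ffun 'I_d -> 'I_q}) : {set 'I_d} :=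
  [set i | f i == g i]%SET.

Lemma agreementC {d q : nat} (f g : {ffun 'I_d -> 'I_q}) : agreement f g = agreement g f.
Proof. by apply/setP => i; rewrite !inE eq_sym. Qed.

Lemma card_agree_on {d q : nat} (f : {ffun 'I_d -> 'I_q}) (S : {set 'I_d}) :
  #|[set g | S \subset agreement f g]%SET| = (q ^ (d - #|S|))%N.
Proof.
pose P i := if i \in S then pred1 (f i) else predT.
have -> : #|[set g | S \subset agreement f g]%SET| = #|family P|.
  rewrite cardsE; apply: eq_card => g; rewrite -[LHS]/(S \subset agreement f g).
  apply/idP/idP => [/fintype.subsetP h|/familyP h].
    apply/familyP => i; rewrite /P; case: ifP => // /h; by rewrite !inE eq_sym.
  apply/fintype.subsetP => i iS; have := h i; by rewrite /P iS !inE eq_sym.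
rewrite card_family foldrE big_map big_enum /= (bigID (mem S)) /=.
rewrite big1 => [|i iS]; last by rewrite /P iS card1.
rewrite mul1n (eq_bigr (fun=> q)) => [|i /negPf iS]; last by rewrite /P iS card_ord.
rewrite prod_nat_const; congr (q ^ _)%N.
have := cardC (mem S); rewrite card_ord => /(congr1 (subn^~ #|S|)) <-; by rewrite addKn.
Qed.

(** Such a function agrees with f on some k-element set S; there are at most 2 ^ d
    sets S, and q ^ (d - k) functions for each. *)
Lemma card_agreement_ball {d q k : nat} (f : {ffun 'I_d -> 'I_q}) :
  (#|[set g | (k <= #|agreement f g|)%N]%SET| <= 2 ^ d * q ^ (d - k))%N.
Proof.
pose D := [set S : {set 'I_d} | #|S| == k]%SET.
have sub : [set g | (k <= #|agreement f g|)%N]%SET \subset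
    (\bigcup_(S in D) [set g | S \subset agreement f g])%SET.
  apply/fintype.subsetP => g; rewrite inE => kg.
  have [S SA Sk] : exists2 S : {set 'I_d}, S \subset agreement f g & #|S| = k.
    exists [set x in take k (enum (agreement f g))]%SET.
      by apply/fintype.subsetP => x; rewrite inE => /mem_take; rewrite mem_enum.
    rewrite cardsE; have /card_uniqP -> : uniq (take k (enum (agreement f g))).
      by apply: take_uniq; exact: enum_uniq.
    by rewrite size_takel // -cardE.
  by apply/bigcupP; exists S; rewrite inE ?Sk.
apply: leq_trans (subset_leq_card sub) _; apply: leq_trans (card_bigcup_leq _ _) _.
rewrite (eq_bigr (fun=> q ^ (d - k))%N) => [|S]; last by rewrite card_agree_on inE => /eqP ->.
rewrite sum_nat_const leq_mul2r; apply/orP; right.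
rewrite -[X in (2 ^ X)%N]card_ord -cardsT -card_powerset; apply: subset_leq_card.
by apply/fintype.subsetP => S _; rewrite powersetE finset.subsetT.
Qed.

(** A maximal code: the balls around its words cover all words, since a word
    outside all of them could be added. *)
Lemma gilbert_varshamov (d q k : nat) : (k <= d)%N ->
  exists F : {set {ffun 'I_d -> 'I_q}},
    (forall f g, f \in F -> g \in F -> f != g -> (#|agreement f g| < k)%N) /\
    (q ^ d <= #|F| * (2 ^ d * q ^ (d - k)))%N.
Proof.
move=> kd.
pose P (F : {set {ffun 'I_d -> 'I_q}}) :=
  [forall f in F, forall g in F, (f != g) ==> (#|agreement f g| < k)%N].
have PP (F : {set {ffun 'I_d -> 'I_q}}) : reflect
    (forall f g, f \in F -> g \in F -> f != g -> (#|agreement f g| < k)%N) (P F).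
  apply: (iffP idP) => [/forall_inP h f g fF gF fg|h].
    by have /forall_inP/(_ g gF)/implyP/(_ fg) := h f fF.
  by apply/forall_inP => f fF; apply/forall_inP => g gF; apply/implyP; exact: h.
have [F /maxsetP[/PP PF Fmax]] : {F : {set {ffun 'I_d -> 'I_q}} | maxset P F}.
  apply: ex_maxset; exists (finset.set0 : {set {ffun 'I_d -> 'I_q}}).
  by apply/PP => f g; rewrite inE.
exists F; split=> //.
have cover : [set: {ffun 'I_d -> 'I_q}]%SET \subset
    (\bigcup_(f in F) [set g | (k <= #|agreement f g|)%N])%SET.
  apply/fintype.subsetP => g _; apply: contrapT => ng.
  have far f : f \in F -> (#|agreement f g| < k)%N.
    move=> fF; rewrite ltnNge; apply/negP => kfg; apply: ng.
    by apply/bigcupP; exists f; rewrite ?inE.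
  have gF : g \notin F.
    apply/negP => /far; rewrite ltnNge; apply/negP; rewrite negbK.
    have -> : agreement g g = [set: 'I_d]%SET by apply/setP => i; rewrite !inE eqxx.
    by rewrite cardsT card_ord.
  have /Fmax : P (g |: F)%SET.
    apply/PP => f h; rewrite !in_setU1 => /orP[/eqP->|fF] /orP[/eqP->|hF].
    - by rewrite eqxx.
    - by move=> _; rewrite agreementC far.
    - by move=> _; rewrite far.
    - exact: PF.
  by move/(_ (finset.subsetUr _ _)) => FE; move: gF; rewrite -FE setU11.
have -> : (q ^ d = #|[set: {ffun 'I_d -> 'I_q}]%SET|)%N by rewrite cardsT card_ffun !card_ord.
apply: leq_trans (subset_leq_card cover) _; apply: leq_trans (card_bigcup_leq _ _) _.
by rewrite -sum_nat_const; apply: leq_sum => f _; exact: card_agreement_ball.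
Qed.

(** A function is replaced by its graph, so that agreements become common elements.
    The index ord0 is left out of the sets, because it has a role of its own in the
    vectors built from them. *)
Lemma sparse_set_family (n d q k : nat) : (k <= d)%N -> (d * q <= n)%N ->
  exists F : {set {set 'I_n.+1}},
    [/\ forall A, A \in F -> #|A| = d /\ ord0 \notin A,
        forall A B, A \in F -> B \in F -> A != B -> (#|A :&: B|%SET < k)%N
      & (q ^ d <= #|F| * (2 ^ d * q ^ (d - k)))%N].
Proof.
move=> kd dqn; have [C [Cfar Ccard]] := gilbert_varshamov d q k kd.
pose pt i a : 'I_n.+1 := lift ord0 (widen_ord dqn (@mxvec_index d q i a)).
have pt_inj i a j b : pt i a = pt j b -> i = j /\ a = b.
  by move=> /lift_inj/(congr1 val) /= /val_inj/enum_rank_inj[].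
pose gr (f : {ffun 'I_d -> 'I_q}) := [set pt i (f i) | i : 'I_d]%SET.
have grP f i a : (pt i a \in gr f) = (f i == a).
  by apply/imsetP/eqP => [[j _ /pt_inj[-> ->]]|<-] //; exists i.
have gr_inj : injective gr.
  by move=> f g fg; apply/ffunP => i; apply/eqP; rewrite eq_sym -grP -fg grP.
exists [set gr f | f in C]%SET; split.
- move=> _ /imsetP[f _ ->]; split.
    by rewrite card_imset ?card_ord // => i j /pt_inj[].
  by apply/imsetP => -[i _] /(congr1 val).
- move=> _ _ /imsetP[f fC ->] /imsetP[g gC ->] fg.
  apply: leq_ltn_trans (Cfar f g fC gC _); last by apply: contraNneq fg => ->.
  apply: leq_trans (leq_imset_card (fun i => pt i (f i)) (agreement f g)).
  apply: subset_leq_card; apply/fintype.subsetP => _ /finset.setIP[/imsetP[i _ ->]].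
  by rewrite grP => h; apply: imset_f; rewrite inE eq_sym.
- by rewrite card_imset.
Qed.

(** * Witnesses and cut normals *)

Lemma sum_three_valued {R : realType} {n : nat} (A : {set 'I_n.+1}) (a b c : R) :
  ord0 \notin A ->
  \sum_j (if j == ord0 then a else if j \in A then b else c) =
  a + b * #|A|%:R + c * (n%:R - #|A|%:R).
Proof.
move=> A0; pose f j := if j \in A then b else c.
have -> : \sum_j (if j == ord0 then a else f j) = a - c + \sum_j f j.
  rewrite (bigD1 ord0) //= [in RHS](bigD1 ord0) //= {2}/f (negPf A0) addrA subrK.
  by congr (_ + _); apply: eq_bigr => j /negPf ->.
rewrite (bigID (mem A)) /= (eq_bigr (fun=> b)) => [|j jA]; last by rewrite /f jA.
rewrite (eq_bigr (P := [pred j | j \notin A]) (fun=> c)) => [|j /negPf jA]; last by rewrite /f jA.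
have := cardC (mem A); rewrite card_ord => /(congr1 (fun k => k%:R : R)); rewrite natrD.
rewrite !sumr_const -[b *+ _]mulr_natr -[c *+ _]mulr_natr -(natr1 n).
rewrite [#|[predC mem A]|](_ : _ = #|[pred j | j \notin A]|) // => h.
have -> : #|[pred j | j \notin A]|%:R = n%:R + 1 - #|A|%:R :> R by rewrite -h addrC addKr.
rewrite (_ : #|mem A| = #|A|) //; ring.
Qed.

Lemma frame_combination {R : realType} {n : nat} (U : 'I_n.+1 -> 'rV[R]_n)
    (z : 'I_n.+1 -> R) (j : 'I_n.+1) : simplex_frame U ->
  dotp (\sum_i z i *: U i) (U j) = (1 + n%:R^-1) * z j - (\sum_i z i) / n%:R.
Proof.
move=> [g _ _]; rewrite dotp_suml; under eq_bigr do rewrite dotpZl g mulrBr.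
rewrite sumrB -mulr_suml; congr (_ - _).
rewrite (bigD1 j) //= eqxx mulr1 mulrC big1 ?addr0 // => i /negPf ->.
by rewrite !mulr0.
Qed.

(** The barycentric coordinates of the witness. The value outside of A is the one
    that makes their sum vanish ([sum_witness_coef]); for #|A| of order n^2 / r^2 it
    is of order 1 / r. *)
Definition witness_coef {R : realType} {n : nat} (A : {set 'I_n.+1}) (j : 'I_n.+1) : R :=
  if j == ord0 then -1 else if j \in A then - (4 / Num.sqrt #|A|%:R)
  else (4 * Num.sqrt #|A|%:R + 1) / (n%:R - #|A|%:R).

Definition witness {R : realType} {n : nat} (U : 'I_n.+1 -> 'rV[R]_n)
    (A : {set 'I_n.+1}) : 'rV[R]_n := \sum_j witness_coef A j *: U j.

(** The value at ord0 is positive whereas the one of the witness is negative; the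
    values are scaled to keep the norm of [cut_normal] at most 1. *)
Definition cut_coef {R : realType} {n : nat} (B : {set 'I_n.+1}) (j : 'I_n.+1) : R :=
  if j == ord0 then 2^-1 else if j \in B then - (2 * Num.sqrt #|B|%:R)^-1 else 0.

Definition cut_normal {R : realType} {n : nat} (U : 'I_n.+1 -> 'rV[R]_n)
    (B : {set 'I_n.+1}) : 'rV[R]_n := \sum_j cut_coef B j *: U j.

Lemma sqrtr_nat_sq {R : realType} (d : nat) :
  Num.sqrt d%:R * Num.sqrt d%:R = d%:R :> R.
Proof. by rewrite -expr2 sqr_sqrtr. Qed.

Lemma sum_witness_coef {R : realType} {n : nat} (A : {set 'I_n.+1}) :
  ord0 \notin A -> (0 < #|A| < n)%N -> \sum_j witness_coef A j = 0 :> R.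
Proof.
move=> A0 /andP[d0 dn]; rewrite sum_three_valued //.
have s0 : 0 < Num.sqrt #|A|%:R :> R by rewrite sqrtr_gt0 ltr0n.
have n0 : 0 < n%:R - #|A|%:R :> R by rewrite subr_gt0 ltr_nat.
move: s0 n0 (@sqrtr_nat_sq R #|A|); move: (Num.sqrt _) => s s0 + sE; rewrite -sE => n0.
by field; rewrite !gt_eqF.
Qed.

Lemma dotp_witness {R : realType} {n : nat} (U : 'I_n.+1 -> 'rV[R]_n)
    (A : {set 'I_n.+1}) (j : 'I_n.+1) : simplex_frame U -> ord0 \notin A ->
  (0 < #|A| < n)%N -> dotp (witness U A) (U j) = (1 + n%:R^-1) * witness_coef A j.
Proof.
by move=> fU A0 dn; rewrite frame_combination // sum_witness_coef // mul0r subr0.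
Qed.

Lemma natrV_le1 {R : realType} (n : nat) : n%:R^-1 <= 1 :> R.
Proof.
case: n => [|n]; first by rewrite invr0 ler01.
by rewrite invf_le1 ?ltr0n // ler1n.
Qed.

Lemma dotp_witness_frame_le {R : realType} {n : nat} (U : 'I_n.+1 -> 'rV[R]_n)
    (A : {set 'I_n.+1}) (j : 'I_n.+1) : simplex_frame U -> ord0 \notin A ->
  (0 < #|A| < n)%N ->
  dotp (witness U A) (U j) <= 2 * ((4 * Num.sqrt #|A|%:R + 1) / (n%:R - #|A|%:R)).
Proof.
move=> fU A0 dn; rewrite dotp_witness //; have /andP[d0 dn'] := dn.
have s0 : 0 < Num.sqrt #|A|%:R :> R by rewrite sqrtr_gt0 ltr0n.
have n0 : 0 < n%:R - #|A|%:R :> R by rewrite subr_gt0 ltr_nat.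
set t := (_ / (_ - _)).
have t0 : 0 <= t by rewrite divr_ge0 ?(ltW n0) // addr_ge0 // mulr_ge0 // ltW.
have k1 : 0 <= 1 + n%:R^-1 :> R by rewrite addr_ge0 // invr_ge0.
have k2 : 1 + n%:R^-1 <= 2 :> R by have := @natrV_le1 R n; lra.
apply: (@le_trans _ _ ((1 + n%:R^-1) * t)); last by rewrite ler_wpM2r.
apply: ler_wpM2l => //; rewrite /witness_coef; case: ifP => _; first lra.
case: ifP => _ //; apply: le_trans t0; rewrite oppr_le0 divr_ge0 // ltW.
Qed.

Lemma dotp_witness_cut {R : realType} {n : nat} (U : 'I_n.+1 -> 'rV[R]_n)
    (A B : {set 'I_n.+1}) : simplex_frame U -> ord0 \notin A -> ord0 \notin B ->
  (0 < #|A| < n)%N -> #|B| = #|A| ->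
  dotp (witness U A) (cut_normal U B) = (1 + n%:R^-1) / 2 *
    (-1 + 4 * #|(A :&: B)%SET|%:R / #|A|%:R -
     (4 * Num.sqrt #|A|%:R + 1) / (n%:R - #|A|%:R) / Num.sqrt #|A|%:R *
       (#|A|%:R - #|(A :&: B)%SET|%:R)).
Proof.
move=> fU A0 B0 dn BA; rewrite /cut_normal dotp_sumr.
under eq_bigr do rewrite dotpZr dotp_witness // mulrCA.
rewrite -mulr_sumr -[in RHS]mulrA; congr (_ * _).
set s := Num.sqrt #|A|%:R; set th := _ / (_ - _).
have s0 : 0 < s by rewrite sqrtr_gt0 ltr0n; case/andP: dn.
have -> : \sum_j cut_coef B j * witness_coef A j =
    - 2^-1 + \sum_(j in B) (- (2 * s)^-1) * (if j \in A then - (4 / s) else th).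
  rewrite (bigD1 ord0) //= /cut_coef /witness_coef eqxx mulrN1 BA; congr (_ + _).
  rewrite [in RHS]big_mkcond [in RHS](bigD1 ord0) //= (negPf B0) add0r.
  by apply: eq_bigr => j /negPf ->; case: ifP => //; rewrite mul0r.
rewrite -mulr_sumr (bigID (mem A)) /=.
have cI : #|[pred j | (j \in B) && (j \in A)]| = #|(A :&: B)%SET|.
  by apply: eq_card => j; rewrite !inE andbC.
have cD : #|[pred j | (j \in B) && (j \notin A)]|%:R = #|A|%:R - #|(A :&: B)%SET|%:R :> R.
  rewrite -BA -(cardsID A B) finset.setIC natrD addrC addKr; congr (_ %:R).
  by apply: eq_card => j; rewrite !inE andbC.
have -> : \sum_(j in B | j \in A) (if j \in A then - (4 / s) else th) =
    - (4 / s) * #|(A :&: B)%SET|%:R.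
  rewrite (eq_bigr (fun=> - (4 / s))) => [|j /andP[_ ->] //].
  by rewrite sumr_const cI mulr_natr.
have -> : \sum_(j in B | j \notin A) (if j \in A then - (4 / s) else th) =
    th * (#|A|%:R - #|(A :&: B)%SET|%:R).
  rewrite (eq_bigr (fun=> th)) => [|j /andP[_ /negPf ->] //].
  by rewrite sumr_const -cD mulr_natr.
have sE : s * s = #|A|%:R by exact: sqrtr_nat_sq.
clearbody th; clearbody s; rewrite -sE; set t := #|_|%:R.
by field; rewrite gt_eqF.
Qed.

(** The coordinate ord0 contributes the same negative amount to all the products
    of a witness with a cut normal, and this outweighs a small intersection. *)
Lemma dotp_witness_cut_le0 {R : realType} {n : nat} (U : 'I_n.+1 -> 'rV[R]_n)
    (A B : {set 'I_n.+1}) : simplex_frame U -> ord0 \notin A -> ord0 \notin B ->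
  (0 < #|A| < n)%N -> #|B| = #|A| -> (4 * #|(A :&: B)%SET| <= #|A|)%N ->
  dotp (witness U A) (cut_normal U B) <= 0.
Proof.
move=> fU A0 B0 dn BA tA; rewrite dotp_witness_cut //; have /andP[d0 dn'] := dn.
have s0 : 0 < Num.sqrt #|A|%:R :> R by rewrite sqrtr_gt0 ltr0n.
have n0 : 0 < n%:R - #|A|%:R :> R by rewrite subr_gt0 ltr_nat.
have dR : 0 < #|A|%:R :> R by rewrite ltr0n.
apply: mulr_ge0_le0; first by rewrite divr_ge0 // addr_ge0 // invr_ge0.
have h1 : 4 * #|(A :&: B)%SET|%:R / #|A|%:R <= 1 :> R.
  by rewrite ler_pdivrMr // mul1r -natrM ler_nat.
have h2 : 0 <= (4 * Num.sqrt #|A|%:R + 1) / (n%:R - #|A|%:R) / Num.sqrt #|A|%:R *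
    (#|A|%:R - #|(A :&: B)%SET|%:R) :> R.
  apply: mulr_ge0; last first.
    by rewrite subr_ge0 ler_nat; apply: leq_trans tA; rewrite leq_pmull.
  apply: divr_ge0; last exact: ltW.
  by apply: divr_ge0; [rewrite addr_ge0 // mulr_ge0 // ltW | exact: ltW].
lra.
Qed.

(** Here the intersection is the whole set, and contributes 4 against the -1 of
    ord0. *)
Lemma dotp_witness_cut_self {R : realType} {n : nat} (U : 'I_n.+1 -> 'rV[R]_n)
    (A : {set 'I_n.+1}) : simplex_frame U -> ord0 \notin A -> (0 < #|A| < n)%N ->
  1 < dotp (witness U A) (cut_normal U A) <= 3.
Proof.
move=> fU A0 dn; rewrite dotp_witness_cut // finset.setIid subrr mulr0 subr0.
have /andP[d0 _] := dn; rewrite mulfK ?pnatr_eq0 -?lt0n //.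
have := @natrV_le1 R n; have : 0 <= n%:R^-1 :> R by rewrite invr_ge0.
by set k := n%:R^-1 => h1 h2; apply/andP; split; lra.
Qed.

Lemma dotp_cut_le1 {R : realType} {n : nat} (U : 'I_n.+1 -> 'rV[R]_n)
    (B : {set 'I_n.+1}) : simplex_frame U -> ord0 \notin B -> (0 < #|B|)%N ->
  dotp (cut_normal U B) (cut_normal U B) <= 1.
Proof.
move=> fU B0 d0; rewrite {2}/cut_normal dotp_sumr.
under eq_bigr do rewrite dotpZr frame_combination // mulrBr mulrCA.
rewrite sumrB -mulr_sumr -mulr_suml.
set S := \sum_i cut_coef B i.
have SS : 0 <= S * (S / n%:R) by rewrite mulrA divr_ge0 // -expr2 sqr_ge0.
have s0 : 0 < Num.sqrt #|B|%:R :> R by rewrite sqrtr_gt0 ltr0n.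
have -> : \sum_i cut_coef B i * cut_coef B i = 2^-1 :> R.
  rewrite (eq_bigr (fun j => if j == ord0 then 2^-1 * 2^-1 else
      if j \in B then (2 * Num.sqrt #|B|%:R)^-1 * (2 * Num.sqrt #|B|%:R)^-1 else 0)).
    rewrite sum_three_valued // mul0r addr0.
    move: s0 (@sqrtr_nat_sq R #|B|); move: (Num.sqrt _) => s s0 <-.
    by field; rewrite gt_eqF.
  by move=> j _; rewrite /cut_coef; do 2?[case: ifP => _]; rewrite ?mulrNN ?mul0r.
have k2 := @natrV_le1 R n; lra.
Qed.

(** * Truncated simplices *)

Lemma continuous_dotp {R : realType} {n : nat} (u : 'rV[R]_n) :
  continuous (fun x : 'rV[R]_n => dotp x u).
Proof.
apply: continuous_big => [|i _]; first exact: add_continuous.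
move=> x; apply: (@continuous_comp _ _ _ (fun M : 'rV[R]_n => M 0 i) ( *%R^~ (u 0 i))).
  exact: coord_continuous.
exact: mulrr_continuous.
Qed.

Lemma closed_dotp_le {R : realType} {n : nat} (u : 'rV[R]_n) (b : R) :
  closed [set x : 'rV[R]_n | dotp x u <= b].
Proof.
apply: (@preimage_closed _ _ (fun x : 'rV[R]_n => dotp x u) [set y | y <= b]).
  by move=> x _; exact: continuous_dotp.
exact: closed_le.
Qed.

Lemma compact_norm_bounded {R : realType} {n : nat} (K : set 'rV[R]_n) (M : R) :
  closed K -> (forall x, K x -> dotp x x <= M ^+ 2) -> 0 <= M -> compact K.
Proof.
move=> Kcl Kb M0; have box : compact [set v : 'rV[R]_n | forall i, `[- M, M]%classic (v ord0 i)].
  by apply: (@rV_compact R n (fun=> `[- M, M]%classic)) => i; exact: segment_compact.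
apply: (subclosed_compact Kcl box).
move=> x /Kb xM i /=; rewrite in_itv /= -ler_norml -(ger0_norm M0) -ler_sqr ?nnegrE //.
rewrite !real_normK ?num_real //; apply: le_trans xM.
rewrite /dotp (bigD1 i) //= -expr2 lerDl; apply: sumr_ge0 => j _.
by rewrite -expr2 sqr_ge0.
Qed.

(** The topology is that of the supremum norm: the cube of half-side 1 / (n + 1) lies
    in the unit ball. *)
Lemma interior_unit_ball {R : realType} {n : nat} :
  (@unit_ball R n)° 0.
Proof.
apply/nbhs_ballP; exists (n.+1%:R^-1 : R); first by rewrite /= invr_gt0.
move=> x [_ hx]; apply/in_unit_ball.
have hi i : x 0 i * x 0 i <= n.+1%:R^-1.
  have := hx 0 i; rewrite /ball /= mxE sub0r normrN => h.
  rewrite -expr2 -real_normK ?num_real // expr2.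
  apply: (@le_trans _ _ (n.+1%:R^-1 * 1)); last by rewrite mulr1.
  apply: ler_pM => //; first exact: ltW.
  by apply: le_trans (ltW h) _; rewrite invf_le1 ?ltr0n // ler1n.
apply: (@le_trans _ _ (\sum_(i < n) n.+1%:R^-1)); first exact: ler_sum.
by rewrite sumr_const card_ord -[_ *+ n]mulr_natl ler_pdivrMr // mul1r ler_nat.
Qed.

(** An ellipsoid inside K also lies in the simplex, so its volume is at most that of
    the unit ball, with equality only for the ball. *)
Lemma john_ellipsoid_unit_ball {R : realType} {n : nat} (U : 'I_n.+1 -> 'rV[R]_n)
    (K : set 'rV[R]_n) : (0 < n)%N -> simplex_frame U -> @unit_ball R n `<=` K ->
  (forall x i, K x -> dotp x (U i) <= 1) -> john_ellipsoid K (@unit_ball R n).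
Proof.
move=> n0 fU BK KU; have [k k0 vol] := @volume_ellipsoid R n.
have id_tri : upper_triangular (1%:M : 'M[R]_n).
  split=> [i j ij|i]; rewrite mxE ?eqxx ?ltr01 //.
  by case: eqP => // ijE; rewrite ijE ltnn in ij.
have ballE : @unit_ball R n = [set x *m 1%:M + 0 | x in @unit_ball R n].
  apply/seteqP; split => [x Bx|_ [x Bx <-]]; last by rewrite mulmx1 addr0.
  by exists x => //; rewrite mulmx1 addr0.
have volB : volume (@unit_ball R n) = k%:E by rewrite {1}ballE vol // det1 mul1r.
have tri E : ellipsoid E -> exists T c,
    upper_triangular T /\ E = [set x *m T + c | x in @unit_ball R n].
  move=> [c [A Au ->]]; have [Q [T [QQ Tu ->]]] := qr_decomposition A Au.
  by exists T, c; split=> //; exact: unit_ball_mul_orthogonal.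
have inK T c : [set x *m T + c | x in @unit_ball R n] `<=` K ->
    forall i x, dotp x x <= 1 -> dotp (x *m T + c) (U i) <= 1.
  by move=> EK i x x1; apply/KU/EK; exists x => //; apply/in_unit_ball.
split.
  split=> //; first by exists 0, 1%:M; rewrite ?unitmx1.
  move=> _ /tri[T [c [Tu ->]]] EK; rewrite volB vol // lee_fin ger_pMl //.
  by have [] := simplex_max_det U T c n0 fU Tu (inK _ _ EK).
move=> _ [/tri[T [c [Tu ->]]] EK Emax]; have [_ eqc] := simplex_max_det U T c n0 fU Tu (inK _ _ EK).
have [|T1 c0] := eqc; last by rewrite T1 c0 -ballE.
have := Emax _ _ BK; rewrite volB vol // lee_fin => h.
rewrite -(ler_pM2r k0) mul1r; apply: h.
by exists 0, 1%:M; rewrite ?unitmx1.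
Qed.

Definition truncated_simplex {R : realType} {n : nat} (U : 'I_n.+1 -> 'rV[R]_n)
    (V : set 'rV[R]_n) : set 'rV[R]_n :=
  [set x | (forall j, dotp x (U j) <= 1) /\ (forall v, V v -> dotp x v <= 1)].

Lemma unit_ball_truncated_simplex {R : realType} {n : nat} (U : 'I_n.+1 -> 'rV[R]_n)
    (V : set 'rV[R]_n) : simplex_frame U -> (forall v, V v -> dotp v v <= 1) ->
  @unit_ball R n `<=` truncated_simplex U V.
Proof.
move=> fU V1 x x1; have le1 (v : 'rV[R]_n) : dotp v v <= 1 -> dotp x v <= 1.
  move=> v1; apply: le_trans (cauchy_schwarz _ _) _.
  by apply: mulr_ile1; rewrite ?sqrtr_ge0 // -[X in _ <= X]sqrtr1 ler_sqrt.
by split=> [j|v Vv]; apply: le1; [rewrite frame_norm | exact: V1].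
Qed.

Lemma convex_body_truncated_simplex {R : realType} {n : nat} (U : 'I_n.+1 -> 'rV[R]_n)
    (V : set 'rV[R]_n) : (0 < n)%N -> simplex_frame U -> (forall v, V v -> dotp v v <= 1) ->
  convex_body (truncated_simplex U V).
Proof.
move=> n0 fU V1; have nR : 0 < n%:R :> R by rewrite ltr0n.
split.
- (* the products with the U j are at most 1 and have sum zero, hence are at least
     - n; isotropy turns this into a bound on the norm *)
  apply: (@compact_norm_bounded _ _ _ (n.+1%:R * n%:R)); last by rewrite mulr_ge0.
    have -> : truncated_simplex U V = (\bigcap_(j in setT) [set x | dotp x (U j) <= 1]) `&`
        (\bigcap_(v in V) [set x | dotp x v <= 1]).
      apply/seteqP; split => x [h1 h2].
        by split=> [j _|v Vv]; [exact: h1 | exact: h2].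
      by split=> [j|v Vv]; [exact: (h1 j Logic.I) | exact: h2].
    by apply: closedI; apply: closed_bigI => u _; exact: closed_dotp_le.
  move=> x [xU _].
  have lo j : - n%:R <= dotp x (U j).
    have := frame_dotp U x fU; rewrite (bigD1 j) //= => /eqP; rewrite addr_eq0 => /eqP ->.
    rewrite lerN2; apply: (@le_trans _ _ (\sum_(i < n.+1 | i != j) 1)).
      by apply: ler_sum => i _.
    by rewrite sumr_const cardC1 card_ord.
  have sq j : dotp x (U j) * dotp x (U j) <= n%:R ^+ 2.
    rewrite -expr2 -real_normK ?num_real // lerXn2r ?nnegrE //.
    rewrite ler_norml lo /=; apply: le_trans (xU j) _; by rewrite ler1n.
  have : dotp x x <= \sum_j dotp x (U j) * dotp x (U j).
    have := congr1 (dotp x) (frame_isotropy U x fU); rewrite dotp_sumr dotpZr.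
    under eq_bigr do rewrite dotpZr.
    by move=> ->; rewrite ler_peMl ?dotp_ge0 // lerDl invr_ge0.
  move=> h; apply: le_trans h _; apply: (@le_trans _ _ (\sum_(i < n.+1) n%:R ^+ 2)).
    exact: ler_sum.
  rewrite sumr_const card_ord -[_ *+ n.+1]mulr_natl exprMn ler_wpM2r ?sqr_ge0 //.
  by rewrite expr2 ler_peMl // ler1n.
- move=> x y t; rewrite !inE => -[xU xV] [yU yV].
  have t0 : 0 <= t%:num by []. have t1 : t%:num <= 1 by [].
  have cv u : dotp x u <= 1 -> dotp y u <= 1 ->
      dotp (t%:num *: x + (1 - t%:num) *: y) u <= 1.
    move=> xu yu; rewrite dotpDl !dotpZl.
    have := ler_wpM2l t0 xu; have t1' : 0 <= 1 - t%:num by rewrite subr_ge0.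
    have := ler_wpM2l t1' yu; lra.
  by split=> [j|v Vv]; apply: cv => //; [exact: xV | exact: yV].
- exists 0; have := @interior_unit_ball R n; apply: interiorS.
  exact: unit_ball_truncated_simplex.
Qed.

(** * The number of facets *)

(** If the inequality excluded more than 3 r of the points [r *: witness U A], it would
    exclude their average x. But x lies in K: its product with U j is an average of
    numbers that are at most 1, and in its product with a cut normal only one term
    is positive and this term is at most 3 r divided by the number of points. *)
Lemma few_witnesses_per_halfspace {R : realType} {n : nat} (U : 'I_n.+1 -> 'rV[R]_n)
    (d : nat) (F G : {set {set 'I_n.+1}}) (r b : R) (a : 'rV[R]_n) :
  simplex_frame U -> (0 < d < n)%N ->
  (forall A, A \in F -> #|A| = d /\ ord0 \notin A) ->
  (forall A B, A \in F -> B \in F -> A != B -> (4 * #|(A :&: B)%SET| <= d)%N) ->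
  0 < r -> 2 * ((4 * Num.sqrt d%:R + 1) / (n%:R - d%:R)) * r <= 1 ->
  (forall x, truncated_simplex U [set cut_normal U B | B in [set` F]] x -> dotp a x <= b) ->
  {subset G <= F} -> (forall A, A \in G -> b < dotp a (r *: witness U A)) ->
  #|G|%:R <= 3 * r.
Proof.
move=> fU dn Fd Fint r0 hr aK GF Gb; rewrite leNgt; apply/negP => m3.
set m : R := #|G|%:R in m3; have m0 : 0 < m by apply: lt_trans m3; rewrite mulr_gt0.
have rm0 : 0 <= r / m by rewrite divr_ge0 // ltW.
have dnF A : A \in G -> (0 < #|A| < n)%N by move=> /GF/Fd[-> _].
pose x := (r / m) *: \sum_(A in G) witness U A.
have Kx : truncated_simplex U [set cut_normal U B | B in [set` F]] x.
  split=> [j|_ [B /= BF <-]]; rewrite dotpZl dotp_suml.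
    set t := 2 * _ in hr.
    apply: (@le_trans _ _ (r / m * \sum_(A in G) t)).
      apply: ler_wpM2l => //; apply: ler_sum => A AG.
      have [dA A0] := Fd A (GF A AG); rewrite /t -dA.
      by apply: dotp_witness_frame_le => //; exact: dnF.
    rewrite sumr_const -[t *+ _]mulr_natr -/m.
    by have -> : r / m * (t * m) = t * r by field; rewrite gt_eqF.
  apply: (@le_trans _ _ (r / m * 3)); last by rewrite mulrAC ler_pdivrMr // mul1r mulrC ltW.
  apply: ler_wpM2l => //; have [dB B0] := Fd B BF.
  have neg A : A \in G -> A != B -> dotp (witness U A) (cut_normal U B) <= 0.
    move=> AG AB; have [dA A0] := Fd A (GF A AG).
    by apply: dotp_witness_cut_le0 => //; rewrite ?dB ?dA ?Fint //; exact: GF.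
  have [BG|BG] := boolP (B \in G).
    rewrite (bigD1 B) //= -[X in _ <= X]addr0; apply: lerD.
      by have /andP[] := dotp_witness_cut_self U B fU B0 (dnF B BG).
    by apply: sumr_le0 => A /andP[AG AB]; exact: neg.
  apply: (@le_trans _ _ 0) => //; apply: sumr_le0 => A AG; apply: neg => //.
  by apply: contraNneq BG => <-.
have := aK _ Kx; rewrite leNgt => /negP; apply.
rewrite /x dotpZr dotp_sumr mulrAC ltr_pdivlMr // mulr_sumr mulrC /m.
rewrite mulr_natl -sumr_const; apply: ltr_sum => [|A AG]; last first.
  by rewrite -dotpZr Gb.
have [A AG] : exists A, A \in G by apply/card_gt0P; rewrite -(ltr0n R).
by apply/hasP; exists A => //; rewrite mem_index_enum.
Qed.

(** The product of [witness U A] with its own cut normal exceeds 1, so the points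
    [r *: witness U A] are outside of r K, hence of P, and each of them is excluded by
    some inequality in a shortest description of P. *)
Lemma facets_lower_bound {R : realType} {n : nat} (U : 'I_n.+1 -> 'rV[R]_n)
    (d : nat) (F : {set {set 'I_n.+1}}) (r : R) (P : set 'rV[R]_n) :
  simplex_frame U -> (0 < d < n)%N ->
  (forall A, A \in F -> #|A| = d /\ ord0 \notin A) ->
  (forall A B, A \in F -> B \in F -> A != B -> (4 * #|(A :&: B)%SET| <= d)%N) ->
  0 < r -> 2 * ((4 * Num.sqrt d%:R + 1) / (n%:R - d%:R)) * r <= 1 ->
  let K := truncated_simplex U [set cut_normal U B | B in [set` F]] in
  polytope P -> K `<=` P -> P `<=` [set r *: x | x in K] ->
  exists2 N : nat, #|F|%:R <= N%:R * (3 * r) & (`I_N #<= facets P)%card.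
Proof.
move=> fU dn Fd Fint r0 hr K PP KP PK.
have BP : @unit_ball R n `<=` P.
  apply: subset_trans KP; apply: unit_ball_truncated_simplex => // _ [B /= BF <-].
  have [dB B0] := Fd B BF; apply: dotp_cut_le1 => //; rewrite dB.
  by case/andP: dn.
have [s Ps facs] := polytope_halfspaces_facets P PP BP.
exists (size s) => //; pose h0 : 'rV[R]_n * R := (0, 0).
pose G (i : 'I_(size s)) := [set A in F |
  (nth h0 s i).2 < dotp (nth h0 s i).1 (r *: witness U A)]%SET.
have cover : F \subset (\bigcup_(i | true) G i)%SET.
  apply/fintype.subsetP => A AF; apply: contrapT => nA.
  have [dA A0] := Fd A AF.
  have : P (r *: witness U A).
    rewrite Ps => h /(nthP h0)[i si <-]; rewrite leNgt; apply/negP => hlt; apply: nA.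
    by apply/bigcupP; exists (Ordinal si) => //; rewrite inE AF.
  move=> /PK[x [_ xV]] /(scalerI (lt0r_neq0 r0)) xE.
  have := xV (cut_normal U A) (ex_intro2 _ _ A AF erefl); rewrite xE leNgt => /negP; apply.
  by have /andP[] := dotp_witness_cut_self U A fU A0 (etrans (congr1 (fun k => 0 < k < n)%N dA) dn).
have : (#|F| <= \sum_(i < size s) #|G i|)%N.
  exact: leq_trans (subset_leq_card cover) (card_bigcup_leq _ _).
rewrite -(ler_nat R) natr_sum => /le_trans; apply.
apply: (@le_trans _ _ (\sum_(i < size s) 3 * r)).
  apply: ler_sum => i _.
  apply: (@few_witnesses_per_halfspace _ _ U d F (G i) r (nth h0 s i).2 (nth h0 s i).1) => //.
  - by move=> x /KP; rewrite Ps; apply; exact: mem_nth.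
  - by move=> A; rewrite inE => /andP[].
  - by move=> A; rewrite inE => /andP[].
by rewrite sumr_const card_ord -[_ *+ size s]mulr_natl.
Qed.

(** * The choice of parameters *)

(** With w = n / (20 r), the set size is the largest multiple 64 e of 64 up to w^2,
    which is positive because r is at most n / 160; the divisibility lets both the
    code distance and the loss in the size of the code be integral exponents. Since
    r is at least sqrt n, the alphabet size q = n / (64 e) is at least 400, more than
    the 2 ^ 8 that [code_size] requires. *)
Lemma parameter_choice {R : realType} (n : nat) (r : R) : (0 < n)%N ->
  Num.sqrt n%:R <= r <= 160^-1 * n%:R ->
  exists e q : nat, [/\ (0 < e)%N, (2 * (64 * e) < n)%N, (256 <= q)%N &
    [/\ (64 * e * q <= n)%N, (n <= 64 * e * (2 * q))%N,
        20 * Num.sqrt (64 * e)%:R * r <= n%:R,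
        n%:R / r ^+ 2 * n%:R <= 20 ^+ 2 * (128 * e%:R) & r ^+ 2 / n%:R <= q%:R]].
Proof.
move=> n0 /andP[r1 r2].
have nR : 0 < n%:R :> R by rewrite ltr0n.
have r0 : 0 < r by apply: lt_le_trans r1; rewrite sqrtr_gt0.
have rr : n%:R <= r ^+ 2.
  rewrite -[n%:R in X in X <= _]sqr_sqrtr ?(ltW nR) //.
  by rewrite lerXn2r ?nnegrE ?sqrtr_ge0 // ltW.
pose w := n%:R / r / 20.
have wE : 20 * w * r = n%:R by rewrite /w; field; rewrite gt_eqF.
have w8 : 8 <= w.
  by rewrite ler_pdivlMr // ler_pdivlMr //; lra.
have XE : n%:R / r ^+ 2 * n%:R = 20 ^+ 2 * w ^+ 2.
  by rewrite -wE; field; rewrite gt_eqF.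
have Xn : 20 ^+ 2 * w ^+ 2 <= n%:R.
  by rewrite -XE ler_piMl ?(ltW nR) // ler_pdivrMr ?mul1r // exprn_gt0.
pose e := Num.truncn (w ^+ 2 / 64).
have w2 : 64 <= w ^+ 2.
  have -> : 64 = 8 * 8 :> R by ring.
  by rewrite expr2; apply: ler_pM.
have e1 : (0 < e)%N by rewrite truncn_gt0 ler_pdivlMr // mul1r.
have ew : 64 * e%:R <= w ^+ 2.
  by rewrite mulrC -ler_pdivlMr // truncn_le divr_ge0 // sqr_ge0.
have we : w ^+ 2 <= 128 * e%:R.
  have h : w ^+ 2 < (e%:R + 1) * 64 by rewrite -ltr_pdivrMr // natr1 truncnS_gt.
  have : 1 <= e%:R :> R by rewrite ler1n.
  lra.
have dn : (20 * 20 * (64 * e) <= n)%N.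
  by rewrite -(ler_nat R) !natrM -expr2; apply: le_trans Xn; rewrite ler_pM2l.
have d0 : (0 < 64 * e)%N by rewrite muln_gt0.
have q400 : (20 * 20 <= n %/ (64 * e))%N by rewrite leq_divRL.
have q1 : (0 < n %/ (64 * e))%N by apply: leq_trans q400.
have nq : (n <= 64 * e * (2 * (n %/ (64 * e))))%N.
  apply: leq_trans (_ : (n %/ (64 * e)).+1 * (64 * e) <= _)%N; first exact/ltnW/ltn_ceil.
  by rewrite mulnC leq_mul2l mul2n -addnn -(addn1 (n %/ _)) leq_add2l q1 orbT.
exists e, (n %/ (64 * e))%N; split=> //.
- by apply: leq_trans dn; rewrite ltn_pmul2r.
- exact: leq_trans q400.
split=> //; first by rewrite mulnC leq_trunc_div.
- have sw : Num.sqrt (64 * e)%:R <= w.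
    rewrite -(@ger0_norm _ w) ?(le_trans _ w8) // -sqrtr_sqr ler_sqrt ?sqr_ge0 //.
    by rewrite natrM.
  by rewrite -wE ler_pM2r // ler_pM2l.
- by rewrite XE ler_pM2l // exprn_gt0.
- rewrite ler_pdivrMr //; move: nq q1; set q := (n %/ _)%N => nq q1.
  have nq2 : n%:R <= 2 * w ^+ 2 * q%:R.
    have : n%:R <= (64 * e * (2 * q))%:R :> R by rewrite ler_nat.
    have -> : (64 * e * (2 * q))%:R = 2 * (64 * e%:R) * q%:R :> R by rewrite !natrM; ring.
    by move=> /le_trans; apply; rewrite ler_wpM2r // ler_pM2l.
  rewrite -(ler_pM2r nR); apply: le_trans (ler_wpM2l (sqr_ge0 r) nq2) _.
  have -> : r ^+ 2 * (2 * w ^+ 2 * q%:R) = (w * r) ^+ 2 * q%:R * 2 by ring.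
  have -> : w * r = n%:R / 20 by rewrite -wE; field.
  have -> : (n%:R / 20) ^+ 2 * q%:R * 2 = (2 / 20 ^+ 2) * (q%:R * n%:R * n%:R) :> R by field.
  rewrite ler_piMl ?mulr_ge0 ?(ltW nR) // ler_pdivrMr ?exprn_gt0 // mul1r expr2.
  by rewrite -[2]mulr1; apply: ler_pM; rewrite ?ler1n ?ler_nat.
Qed.

(** The bound of [dotp_witness_frame_le] is at most 1 / r, which is what limits d. *)
Lemma witness_frame_bound {R : realType} (n d : nat) (r : R) : (0 < d)%N ->
  (2 * d < n)%N -> 0 < r -> 20 * Num.sqrt d%:R * r <= n%:R ->
  2 * ((4 * Num.sqrt d%:R + 1) / (n%:R - d%:R)) * r <= 1.
Proof.
move=> d0 dn r0 sr; have s1 : 1 <= Num.sqrt d%:R :> R.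
  by rewrite -[X in X <= _]sqrtr1 ler_sqrt // ler1n.
have dR : 2 * d%:R <= n%:R :> R by rewrite -natrM ler_nat ltnW.
have d1 : 1 <= d%:R :> R by rewrite ler1n.
have nR : 0 < n%:R :> R by rewrite ltr0n; case: n dn {sr dR}.
have nd : 0 < n%:R - d%:R :> R by lra.
have h := ler_wpM2r (ltW r0) s1; rewrite mul1r in h.
rewrite mulrA mulrAC ler_pdivrMr // mul1r; lra.
Qed.

(** Of the 16 e in the exponent given by the code distance, the factor 2 ^ (64 e)
    takes at most 8 e, because q is at least 2 ^ 8. *)
Lemma code_size (e q M : nat) : (256 <= q)%N ->
  (q ^ (64 * e) <= M * (2 ^ (64 * e) * q ^ (64 * e - 16 * e)))%N -> (q ^ (8 * e) <= M)%N.
Proof.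
move=> q256; have q0 : (0 < q)%N by apply: leq_trans q256.
have loss : (2 ^ (64 * e) <= q ^ (8 * e))%N.
  have -> : (64 * e = 8 * (8 * e))%N by rewrite mulnA.
  rewrite expnM; have [->|e0] := posnP e; first by rewrite muln0 !expn0.
  by rewrite leq_exp2r // muln_gt0.
have -> : (64 * e - 16 * e = 48 * e)%N by rewrite -mulnBl.
have -> : (q ^ (64 * e) = q ^ (8 * e) * (q ^ (8 * e) * q ^ (48 * e)))%N.
  by rewrite -!expnD -!mulnDl.
move=> h; rewrite -(leq_pmul2r (_ : 0 < q ^ (8 * e) * q ^ (48 * e))%N); last first.
  by rewrite muln_gt0 !expn_gt0 q0.
by apply: leq_trans h _; rewrite leq_mul2l leq_mul2r loss !orbT.
Qed.

Lemma leq_mul_expn (e q : nat) : (0 < e)%N -> (3 <= q)%N -> (3 * (e * q) <= q ^ (4 * e))%N.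
Proof.
move=> e0 q3; have q1 : (1 < q)%N by apply: leq_trans q3.
have -> : (3 * (e * q) = 3 * q * e)%N by rewrite (mulnC e) mulnA.
apply: (@leq_trans (q ^ 2 * q ^ e)).
  by apply: leq_mul; [rewrite expnS expn1 leq_mul2r q3 orbT | rewrite ltnW // ltn_expl].
rewrite -expnD leq_exp2l // (_ : 4 * e = 3 * e + e)%N; last by rewrite -mulSnr.
by rewrite leq_add2r; apply: leq_trans (_ : 3 * 1 <= _)%N; rewrite // leq_mul2l.
Qed.

Theorem theorem1p2 (R : realType) :
  exists c0 c1 C : R, [/\ 0 < c0, 0 < c1 & 0 < C] /\
  exists n0 : nat, forall n : nat, (n0 <= n)%N ->
  forall r : R, c0 * Num.sqrt n%:R <= r <= c1 * n%:R ->
  exists K : set 'rV[R]_n,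
    [/\ convex_body K,
        exists2 E, john_ellipsoid K E & ellipsoid_centered_at 0 E
      & forall P : set 'rV[R]_n, polytope P ->
          K `<=` P -> P `<=` [set r *: x | x in K] ->
          has_at_least_facets P
            (expR (C * ln (r ^+ 2 / n%:R) * (n%:R / r ^+ 2) * n%:R))].
Proof.
exists 1, 160^-1, (20 ^+ 2 * 32)^-1; split.
  by split; [exact: ltr01 | rewrite invr_gt0 ltr0n | rewrite invr_gt0 mulr_gt0 ?exprn_gt0 ?ltr0n].
exists 1%N => n n0 r; rewrite mul1r => hr.
have [e [q [e0 dn q256 [dq nq sr Xe rhoq]]]] := parameter_choice n r n0 hr.
have nR : 0 < n%:R :> R by rewrite ltr0n.
have r0 : 0 < r by case/andP: hr => h _; apply: lt_le_trans h; rewrite sqrtr_gt0.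
have rr : 1 <= r ^+ 2 / n%:R.
  rewrite ler_pdivlMr // mul1r -[n%:R in X in X <= _]sqr_sqrtr ?(ltW nR) //.
  by case/andP: hr => h _; rewrite lerXn2r ?nnegrE ?sqrtr_ge0 // ltW.
have [U fU] := @simplex_frame_exists R n n0.
have [F [Fd Fint Fcard]] := sparse_set_family n (64 * e) q (16 * e)
  (leq_mul (isT : 16 <= 64)%N (leqnn e)) dq.
have Fint4 A B : A \in F -> B \in F -> A != B -> (4 * #|(A :&: B)%SET| <= 64 * e)%N.
  move=> AF BF AB; have -> : (64 * e = 4 * (16 * e))%N by rewrite mulnA.
  by rewrite leq_mul2l ltnW // Fint.
have d0 : (0 < 64 * e)%N by rewrite muln_gt0.
have d0n : (0 < 64 * e < n)%N by rewrite d0 /=; apply: leq_ltn_trans dn; rewrite leq_pmull.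
pose K := truncated_simplex U [set cut_normal U B | B in [set` F]].
have V1 v : [set cut_normal U B | B in [set` F]] v -> dotp v v <= 1.
  by move=> [B /= BF <-]; have [dB B0] := Fd B BF; apply: dotp_cut_le1; rewrite ?dB.
exists K; split.
- exact: convex_body_truncated_simplex.
- exists (@unit_ball R n).
    apply: (john_ellipsoid_unit_ball U) => //; first exact: unit_ball_truncated_simplex.
    by move=> x i [xU _]; exact: xU.
  exists 1%:M; first exact: unitmx1.
  apply/seteqP; split => [x Bx|_ [x Bx <-]]; last by rewrite mulmx1 addr0.
  by exists x => //; rewrite mulmx1 addr0.
move=> P PP KP PK.
have hr2 := witness_frame_bound n (64 * e) r d0 dn r0 sr.
have [N MN facs] := facets_lower_bound U (64 * e) F r P fU d0n Fd Fint4 r0 hr2 PP KP PK.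
exists N => //.
have q0 : (0 < q)%N by apply: leq_trans q256.
have M8 := code_size e q #|F| q256 Fcard.
(* half of the exponent pays for the factor 3 r of [facets_lower_bound] *)
have rq : 3 * r <= (q ^ (4 * e))%:R.
  apply: le_trans (_ : (3 * (e * q))%:R <= _); last first.
    by rewrite ler_nat leq_mul_expn // (leq_trans _ q256).
  have : n%:R <= (64 * e * (2 * q))%:R :> R by rewrite ler_nat.
  have /andP[_ r160] := hr; have : 0 <= e%:R * q%:R :> R by rewrite mulr_ge0.
  rewrite !natrM; lra.
have QN : (q ^ (4 * e))%:R <= N%:R :> R.
  have Q0 : 0 < (q ^ (4 * e))%:R :> R by rewrite ltr0n expn_gt0 q0.
  rewrite -(ler_pM2r Q0) -natrM -expnD (_ : 4 * e + 4 * e = 8 * e)%N; last by rewrite -mulnDl.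
  apply: (@le_trans _ _ #|F|%:R); first by rewrite ler_nat.
  by apply: le_trans MN _; rewrite ler_wpM2l.
apply: le_trans QN.
have qR : 0 < q%:R :> R by rewrite ltr0n.
rewrite natrX -[X in _ <= X ^+ _](@lnK R) ?posrE // -expRM_natl ler_expR.
have l0 : 0 <= ln (r ^+ 2 / n%:R) by exact: ln_ge0.
have lq : ln (r ^+ 2 / n%:R) <= ln q%:R.
  by rewrite ler_ln ?posrE // (lt_le_trans ltr01).
have X0 : 0 <= n%:R / r ^+ 2 * n%:R by rewrite mulr_ge0 ?divr_ge0 ?sqr_ge0 ?(ltW nR).
have k0 : 0 < 20 ^+ 2 :> R by rewrite exprn_gt0.
have := ler_pM X0 l0 Xe lq; move: (20 ^+ 2) k0 => k k0 h.
have -> : (k * 32)^-1 * ln (r ^+ 2 / n%:R) * (n%:R / r ^+ 2) * n%:R =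
  (k * 32)^-1 * (n%:R / r ^+ 2 * n%:R * ln (r ^+ 2 / n%:R)) by ring.
rewrite ler_pdivrMl ?mulr_gt0 // natrM.
by have -> : k * 32 * (4 * e%:R * ln q%:R) = k * (128 * e%:R) * ln q%:R by ring.
Qed.
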